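(* Let $G(\lambda)\in\mathbb F(\lambda)^{p\times m}$ be any rational matrix of rank $r$, let $d=\deg D(\lambda)$ if the polynomial part $D(\lambda)$ of $G$ is nonzero and $d=0$ otherwise, and let $L(\lambda)=\begin{bmatrix} A_1\lambda+A_0 & B_1\lambda+B_0\\ -(C_1\lambda+C_0) & D_1\lambda+D_0\end{bmatrix}\in\mathbb F[\lambda]^{(n+(p+s))\times(n+(m+s))}$ be any strong linearization of $G(\lambda)$. Then $\mu(G)=\mu(L)+dr-(r+s)$ if $D_1+C_1A_1^{-1}B_1\ne 0$; $\mu(G)=\mu(L)+dr$ if $n>0$ and $D_1+C_1A_1^{-1}B_1=0$; and $\mu(G)=dr$ if $n=0$ and $D_1=0$.
   Context: $\mathbb F$ is an arbitrary field. $G=D+G_{sp}$ uniquely with $D$ polynomial and $G_{sp}$ strictly proper. $\mu(\cdot)$ denotes the sum of all right and left minimal indices of a rational matrix (minimal indices: degrees of the vectors of a polynomial basis of least total degree of $\mathcal N_r(G)=\{x:Gx=0\}$, resp. $\mathcal N_\ell(G)=\{x:x^TG=0\}$). A square rational matrix is biproper if it and its inverse are proper; invariant orders at infinity $q_1\le\dots\le q_r$ of $G$ are defined by biproper $B_1,B_2$ with $B_1GB_2=\operatorname{Diag}(\lambda^{-q_1},\dots,\lambda^{-q_r},0)$. $\nu(G)$ is the least order ($\deg\det A$) of a polynomial system matrix $\begin{bmatrix}A&B\\-C&D\end{bmatrix}$ ($A$ regular) with $G=D+CA^{-1}B$. Strong linearization: with $n=\nu(G)$ and $g=\min(0,q_1)$,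 a pencil $L$ of the shape in the claim is a strong linearization of $G$ if $\det(A_1\lambda+A_0)\not\equiv0$ when $n>0$ and, with $\widehat G=(D_1\lambda+D_0)+(C_1\lambda+C_0)(A_1\lambda+A_0)^{-1}(B_1\lambda+B_0)$ and $\widehat g=\min(0,\widehat q_1)$ ($\widehat q_1$ first invariant order at infinity of $\widehat G$), there exist unimodular $U_1,U_2$ with $U_1\operatorname{Diag}(G,I_s)U_2=\widehat G$ and biproper $B_1,B_2$ with $B_1\operatorname{Diag}(\lambda^gG,I_s)B_2=\lambda^{\widehat g}\widehat G$. For strong linearizations with $n>0$, $A_1$ is nonsingular; for $n=0$, $D_1+C_1A_1^{-1}B_1$ means $D_1$. *)

(* Defs.v *)
From HB Require Import structures.
From mathcomp Require Import all_boot all_order all_algebra.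
Set Implicit Arguments. Unset Strict Implicit. Unset Printing Implicit Defensive.
Import Order.TTheory GRing.Theory Num.Theory.
Local Open Scope ring_scope.

Section RationalMatrices.
Variable F : fieldType.

Definition ratF := {fraction {poly F}}.

Definition pr (a : {poly F}) : ratF := tofrac a.

Definition lam : ratF := pr 'X.

Definition prmx m n (P : 'M[{poly F}]_(m, n)) : 'M[ratF]_(m, n) := map_mx pr P.

(* degree of a polynomial (deg 0 := 0) *)
Definition pdeg (a : {poly F}) : nat := (size a).-1.

Definition proper (f : ratF) : Prop :=
  exists a b : {poly F}, [/\ b != 0, f = pr a / pr b & (size a <= size b)%N].
Definition strictly_proper (f : ratF) : Prop :=
  exists a b : {poly F}, [/\ b != 0, f = pr a / pr b & (size a < size b)%N].

Definition proper_mx m n (M : 'M[ratF]_(m, n)) : Prop := forall i j, proper (M i j).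
Definition strictly_proper_mx m n (M : 'M[ratF]_(m, n)) : Prop :=
  forall i j, strictly_proper (M i j).

Definition biproper n (B : 'M[ratF]_n) : Prop :=
  [/\ proper_mx B, B \in unitmx & proper_mx (invmx B)].

Definition unimodular n (U : 'M[{poly F}]_n) : Prop := U \in unitmx.

(* degree of a polynomial matrix: max degree of its entries (0 if zero) *)
Definition pmx_deg m n (P : 'M[{poly F}]_(m, n)) : nat :=
  \max_(i < m) \max_(j < n) pdeg (P i j).

Definition poly_part m n (G : 'M[ratF]_(m, n)) (D : 'M[{poly F}]_(m, n)) : Prop :=
  strictly_proper_mx (G - prmx D).

Definition col_total_deg m k (N : 'M[{poly F}]_(m, k)) : nat :=
  \sum_(j < k) \max_(i < m) pdeg (N i j).
Definition row_total_deg k p (N : 'M[{poly F}]_(k, p)) : nat :=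
  \sum_(i < k) \max_(j < p) pdeg (N i j).

Definition right_poly_basis p m (G : 'M[ratF]_(p, m))
    (N : 'M[{poly F}]_(m, m - \rank G)) : Prop :=
  G *m prmx N = 0 /\ \rank (prmx N) = (m - \rank G)%N.

Definition left_poly_basis p m (G : 'M[ratF]_(p, m))
    (N : 'M[{poly F}]_(p - \rank G, p)) : Prop :=
  prmx N *m G = 0 /\ \rank (prmx N) = (p - \rank G)%N.

Arguments right_poly_basis {p m} G N.
Arguments left_poly_basis {p m} G N.

(* k is the sum of the right minimal indices of G *)
Definition right_min_sum p m (G : 'M[ratF]_(p, m)) (k : nat) : Prop :=
  (exists N, right_poly_basis G N /\ col_total_deg N = k) /\
  (forall N, right_poly_basis G N -> (k <= col_total_deg N)%N).

(* k is the sum of the left minimal indices of G *)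
Definition left_min_sum p m (G : 'M[ratF]_(p, m)) (k : nat) : Prop :=
  (exists N, left_poly_basis G N /\ row_total_deg N = k) /\
  (forall N, left_poly_basis G N -> (k <= row_total_deg N)%N).

Definition mu p m (G : 'M[ratF]_(p, m)) (k : nat) : Prop :=
  exists kr kl, [/\ right_min_sum G kr, left_min_sum G kl & k = (kr + kl)%N].

Definition inf_orders p m (G : 'M[ratF]_(p, m)) (q : seq int) : Prop :=
  [/\ size q = \rank G, sorted <=%R q &
    exists (B1 : 'M[ratF]_p) (B2 : 'M[ratF]_m),
      [/\ biproper B1, biproper B2 &
        B1 *m G *m B2 =
        \matrix_(i < p, j < m)
          (if ((i : nat) == j) && (i < \rank G)%N then lam ^ (- q`_i) else 0)]].

(* g = min(0, q_1)  (for G = 0, where q is empty, this gives g = 0; the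
   value of g is then irrelevant since lambda^g G = 0) *)
Definition inf_g p m (G : 'M[ratF]_(p, m)) (g : int) : Prop :=
  exists q, inf_orders G q /\ g = Num.min 0 (head 0 q).

(* G = D + C A^{-1} B for a polynomial system matrix [A B; -C D], A regular *)
Definition realizes p m (G : 'M[ratF]_(p, m)) k (A : 'M[{poly F}]_k)
  (B : 'M[{poly F}]_(k, m)) (C : 'M[{poly F}]_(p, k)) (D : 'M[{poly F}]_(p, m)) :=
  \det A != 0 /\ G = prmx D + prmx C *m invmx (prmx A) *m prmx B.

Definition least_order p m (G : 'M[ratF]_(p, m)) (n : nat) : Prop :=
  (exists k A B C D, @realizes p m G k A B C D /\ pdeg (\det A) = n) /\
  (forall k A B C D, @realizes p m G k A B C D -> (n <= pdeg (\det A))%N).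

Definition pencil m n (M1 M0 : 'M[F]_(m, n)) : 'M[{poly F}]_(m, n) :=
  \matrix_(i, j) ((M1 i j)%:P * 'X + (M0 i j)%:P).

Definition lin_pencil n p m s (A1 A0 : 'M[F]_n) (B1 B0 : 'M[F]_(n, m + s))
  (C1 C0 : 'M[F]_(p + s, n)) (D1 D0 : 'M[F]_(p + s, m + s))
  : 'M[{poly F}]_(n + (p + s), n + (m + s)) :=
  block_mx (pencil A1 A0) (pencil B1 B0) (- pencil C1 C0) (pencil D1 D0).

Definition lin_transfer n p m s (A1 A0 : 'M[F]_n) (B1 B0 : 'M[F]_(n, m + s))
  (C1 C0 : 'M[F]_(p + s, n)) (D1 D0 : 'M[F]_(p + s, m + s))
  : 'M[ratF]_(p + s, m + s) :=
  prmx (pencil D1 D0)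
  + prmx (pencil C1 C0) *m invmx (prmx (pencil A1 A0)) *m prmx (pencil B1 B0).

Definition diagI p m s (H : 'M[ratF]_(p, m)) : 'M[ratF]_(p + s, m + s) :=
  block_mx H 0 0 1%:M.

Definition strong_linearization p m (G : 'M[ratF]_(p, m)) n s
  (A1 A0 : 'M[F]_n) (B1 B0 : 'M[F]_(n, m + s))
  (C1 C0 : 'M[F]_(p + s, n)) (D1 D0 : 'M[F]_(p + s, m + s)) : Prop :=
  let Gh := lin_transfer A1 A0 B1 B0 C1 C0 D1 D0 in
  [/\ least_order G n,
      (0 < n)%N -> \det (pencil A1 A0) != 0,
      exists (U1 : 'M[{poly F}]_(p + s)) (U2 : 'M[{poly F}]_(m + s)),
        [/\ unimodular U1, unimodular U2 & prmx U1 *m diagI s G *m prmx U2 = Gh]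
    & exists (g gh : int), [/\ inf_g G g, inf_g Gh gh &
        exists (Bl : 'M[ratF]_(p + s)) (Br : 'M[ratF]_(m + s)),
          [/\ biproper Bl, biproper Br &
            Bl *m diagI s (lam ^ g *: G) *m Br = lam ^ gh *: Gh]]].

End RationalMatrices.

(* Main.v *)
Require Import Defs.
From HB Require Import structures.
From mathcomp Require Import all_boot all_order all_algebra.
From mathcomp Require Import perm ring zify.
Import Order.TTheory GRing.Theory Num.Theory.
Set Implicit Arguments. Unset Strict Implicit. Unset Printing Implicit Defensive.
Local Open Scope ring_scope.

(* Let S be either F[lambda] or the ring of proper rational functions.  Write
   G = X H Y with H square nonsingular, X left invertible over S and Y right
   invertible over S; then deg det H depends only on G and S.  Calling these
   numbers delta_fin(G) and delta_inf(G), the index sum theorem reads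
   mu(G) = delta_inf(G) - delta_fin(G): a minimal basis of the kernel extends to a
   unimodular matrix and, once its columns are divided by the powers of lambda
   given by their degrees, to a biproper one, and comparing the determinants of the
   two completions produces the minimal indices.
   For a strong linearization, minimality of n forces the pencil to be a coprime
   realization of the transfer function Gh, so delta_fin(L) = n + delta_fin(Gh) and
   delta_inf(L) = n + delta_inf(Gh).  The unimodular equivalence gives
   delta_fin(Gh) = delta_fin(G), and the biproper one relates delta_inf(Gh) to
   delta_inf(G) up to the shifts g r and gh (r + s).  Finally g = - d, and gh is - 1
   or 0 according to whether D1 + C1 A1^-1 B1 is nonzero or zero. *)

(** * Subrings of a field and the index delta *)

Section Generic.
Variable K : fieldType.
Implicit Types (x y : K).

Lemma det_neq0 n (A : 'M[K]_n) : A \in unitmx -> \det A != 0.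
Proof. by rewrite unitmxE unitfE. Qed.

Lemma det_unit n (A : 'M[K]_n) : \det A != 0 -> A \in unitmx.
Proof. by rewrite unitmxE unitfE. Qed.

Record subring (S : K -> Prop) : Prop := Subring {
  subring1 : S 1;
  subringB : forall x y, S x -> S y -> S (x - y);
  subringM : forall x y, S x -> S y -> S (x * y) }.

Definition mxover (S : K -> Prop) m n (M : 'M[K]_(m, n)) := forall i j, S (M i j).

Section Over.
Variable S : K -> Prop.
Hypothesis rS : subring S.

Lemma subring0 : S 0.
Proof. by rewrite -(subrr 1); apply: (subringB rS); apply: (subring1 rS). Qed.

Lemma subringN x : S x -> S (- x).
Proof. by move=> hx; rewrite -sub0r; apply: (subringB rS) => //; apply: subring0. Qed.

Lemma subringD x y : S x -> S y -> S (x + y).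
Proof. by move=> hx hy; rewrite -[y]opprK; apply: (subringB rS) => //; apply: subringN. Qed.

Lemma subring_sum I (r : seq I) (P : pred I) (f : I -> K) :
  (forall i, P i -> S (f i)) -> S (\sum_(i <- r | P i) f i).
Proof. by move=> h; apply: big_ind => //; [exact: subring0|exact: subringD]. Qed.

Lemma subring_prod I (r : seq I) (P : pred I) (f : I -> K) :
  (forall i, P i -> S (f i)) -> S (\prod_(i <- r | P i) f i).
Proof. by move=> h; apply: big_ind => //; [exact: (subring1 rS)|exact: (subringM rS)]. Qed.

Lemma mxoverM m n p (A : 'M[K]_(m, n)) (B : 'M[K]_(n, p)) :
  mxover S A -> mxover S B -> mxover S (A *m B).
Proof. by move=> hA hB i j; rewrite mxE; apply: subring_sum => u _; apply: (subringM rS). Qed.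

Lemma mxoverB m n (A B : 'M[K]_(m, n)) : mxover S A -> mxover S B -> mxover S (A - B).
Proof. by move=> hA hB i j; rewrite !mxE; apply: (subringB rS). Qed.

Lemma mxoverN m n (A : 'M[K]_(m, n)) : mxover S A -> mxover S (- A).
Proof. by move=> hA i j; rewrite !mxE; apply: subringN. Qed.

Lemma mxover_tr m n (A : 'M[K]_(m, n)) : mxover S A -> mxover S A^T.
Proof. by move=> hA i j; rewrite mxE. Qed.

Lemma mxover0 m n : mxover S (0 : 'M[K]_(m, n)).
Proof. by move=> i j; rewrite mxE; apply: subring0. Qed.

Lemma mxover1 n : mxover S (1%:M : 'M[K]_n).
Proof. by move=> i j; rewrite mxE; case: (_ == _); [apply: (subring1 rS)|apply: subring0]. Qed.

Lemma mxover_row m n p (A : 'M[K]_(m, n)) (B : 'M[K]_(m, p)) :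
  mxover S A -> mxover S B -> mxover S (row_mx A B).
Proof. by move=> hA hB i j; rewrite mxE; case: split. Qed.

Lemma mxover_col m n p (A : 'M[K]_(m, n)) (B : 'M[K]_(p, n)) :
  mxover S A -> mxover S B -> mxover S (col_mx A B).
Proof. by move=> hA hB i j; rewrite mxE; case: split. Qed.

Lemma mxover_block m n p q (A : 'M[K]_(m, n)) (B : 'M[K]_(m, p))
    (C : 'M[K]_(q, n)) (E : 'M[K]_(q, p)) :
  mxover S A -> mxover S B -> mxover S C -> mxover S E -> mxover S (block_mx A B C E).
Proof. by move=> hA hB hC hE; apply: mxover_col; apply: mxover_row. Qed.

Lemma mxover_rsub m n p (A : 'M[K]_(m, n + p)) : mxover S A -> mxover S (rsubmx A).
Proof. by move=> hA i j; rewrite mxE. Qed.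
Lemma mxover_usub m n p (A : 'M[K]_(m + n, p)) : mxover S A -> mxover S (usubmx A).
Proof. by move=> hA i j; rewrite mxE. Qed.
Lemma mxover_dsub m n p (A : 'M[K]_(m + n, p)) : mxover S A -> mxover S (dsubmx A).
Proof. by move=> hA i j; rewrite mxE. Qed.

Lemma mxover_det n (A : 'M[K]_n) : mxover S A -> S (\det A).
Proof.
move=> hA; apply: subring_sum => s _; apply: (subringM rS); last exact: subring_prod.
by case: (odd_perm s); rewrite ?expr0 ?expr1;
  [apply: subringN|]; apply: (subring1 rS).
Qed.

Lemma mxover_invmx n (A : 'M[K]_n) : A \in unitmx ->
  mxover S A -> S (\det A)^-1 -> mxover S (invmx A).
Proof.
move=> uA hA hd i j; rewrite /invmx uA !mxE; apply: (subringM rS) => //.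
apply: (subringM rS).
  by rewrite -signr_odd; case: odd; rewrite ?expr0 ?expr1;
    [apply: subringN|]; apply: (subring1 rS).
by apply: mxover_det => u v; rewrite !mxE.
Qed.

End Over.

(* The header's delta(G), as a relation; the rank [r] of [G] is a separate
   parameter so that block sizes add up definitionally. *)
Definition delta (deg : K -> int) (S : K -> Prop) p m (G : 'M[K]_(p, m)) (r : nat) (z : int) :=
  exists (X : 'M[K]_(p, r)) (X' : 'M[K]_(r, p)) (H : 'M[K]_r)
         (Y : 'M[K]_(r, m)) (Y' : 'M[K]_(m, r)),
  [/\ [/\ mxover S X, mxover S X', mxover S Y & mxover S Y'],
      X' *m X = 1%:M, Y *m Y' = 1%:M, G = X *m H *m Y &
      H \in unitmx /\ deg (\det H) = z].

(** The one-sided inverses recover [H] as [X' G Y'], so the rank cannot drop below [r]. *)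
Lemma delta_rank deg S p m (G : 'M[K]_(p, m)) r z : delta deg S G r z -> \rank G = r.
Proof.
move=> [X [X' [H [Y [Y' [_ hX hY eG [uH _]]]]]]].
apply/eqP; rewrite eqn_leq; apply/andP; split.
  by rewrite eG; apply: leq_trans (mxrankM_maxl _ _) (rank_leq_col _).
have eH : H = X' *m G *m Y'.
  by rewrite eG !mulmxA hX mul1mx -mulmxA hY mulmx1.
rewrite -[leqLHS](mxrank_unit uH) {1}eH.
exact: leq_trans (mxrankM_maxl _ _) (mxrankM_maxr _ _).
Qed.

(** * Rules of computation for [delta] *)

Section Delta.
Variable deg : K -> int.
Hypothesis degM : forall x y, x != 0 -> y != 0 -> deg (x * y) = deg x + deg y.

Lemma deg_one : deg 1 = 0.
Proof.
by apply: (addIr (deg 1)); rewrite add0r -degM ?oner_neq0 // mulr1.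
Qed.

Lemma deg_expr x (n : nat) : x != 0 -> deg (x ^+ n) = deg x * n%:Z.
Proof.
move=> x0; elim: n => [|n IH]; first by rewrite expr0 deg_one mulr0.
by rewrite exprS degM ?expf_neq0 // IH -addn1 PoszD mulrDr mulr1 addrC.
Qed.

(** The scalar goes into the core [H], of size [r], whose determinant it multiplies by [c ^+ r]. *)
Lemma delta_scale S p m (G : 'M[K]_(p, m)) r z (c : K) : c != 0 ->
  delta deg S G r z -> delta deg S (c *: G) r (z + deg c * r%:Z).
Proof.
move=> c0 [X [X' [H [Y [Y' [hS hX hY eG [uH dH]]]]]]].
exists X, X', (c *: H), Y, Y'; split; [exact: hS|exact: hX|exact: hY| |].
  by rewrite eG -scalemxAr -scalemxAl.
split; first by rewrite unitmxZ // unitfE.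
rewrite detZ degM ?expf_neq0 //; last by rewrite -unitfE -unitmxE.
by rewrite dH deg_expr // addrC.
Qed.

Variable S : K -> Prop.
Hypothesis rS : subring S.

Lemma delta_mul p m p' m' (G : 'M[K]_(p, m)) r z (U : 'M[K]_(p', p))
    (U' : 'M[K]_(p, p')) (V : 'M[K]_(m, m')) (V' : 'M[K]_(m', m)) :
  mxover S U -> mxover S U' -> mxover S V -> mxover S V' ->
  U' *m U = 1%:M -> V *m V' = 1%:M ->
  delta deg S G r z -> delta deg S (U *m G *m V) r z.
Proof.
move=> sU sU' sV sV' hU hV [X [X' [H [Y [Y' [[a b c d] hX hY eG uH]]]]]].
exists (U *m X), (X' *m U'), H, (Y *m V), (V' *m Y'); split; last exact: uH.
- by split; apply: mxoverM.
- by rewrite mulmxA -(mulmxA X') hU mulmx1.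
- by rewrite mulmxA -(mulmxA Y) hV mulmx1.
- by rewrite eG !mulmxA.
Qed.

Lemma delta_block1 p m s (G : 'M[K]_(p, m)) r z :
  delta deg S G r z -> delta deg S (block_mx G 0 0 (1%:M : 'M[K]_s)) (r + s) z.
Proof.
move=> [X [X' [H [Y [Y' [[a b c d] hX hY eG [uH dH]]]]]]].
exists (block_mx X 0 0 1%:M), (block_mx X' 0 0 1%:M), (block_mx H 0 0 1%:M),
  (block_mx Y 0 0 1%:M), (block_mx Y' 0 0 1%:M); split.
- by split; apply: mxover_block => //; try exact: mxover0; apply: mxover1.
- by rewrite mulmx_block !(mulmx0, mul0mx, mulmx1, mul1mx, addr0, add0r) hX -scalar_mx_block.
- by rewrite mulmx_block !(mulmx0, mul0mx, mulmx1, mul1mx, addr0, add0r) hY -scalar_mx_block.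
- rewrite !mulmx_block !(mulmx0, mul0mx, mulmx1, mul1mx, addr0, add0r) eG.
  by [].
- by split; rewrite ?unitmxE det_ublock det1 mulr1.
Qed.

Hypothesis uS : forall x y, S x -> S y -> x * y = 1 -> deg x = 0.

(** Each core is the other one multiplied on both sides by matrices over [S], so the two
    determinants differ by a unit of [S], which has degree 0. *)
Lemma delta_uniq p m (G : 'M[K]_(p, m)) r z1 z2 :
  delta deg S G r z1 -> delta deg S G r z2 -> z1 = z2.
Proof.
move=> [X [X' [H [Y [Y' [[a b c d] hX hY eG [uH <-]]]]]]].
move=> [W [W' [E [Z [Z' [[e f g h] hW hZ eG2 [uE <-]]]]]]].
have eH : H = (X' *m W) *m E *m (Z *m Y').
  have : X' *m G *m Y' = H by rewrite eG !mulmxA hX mul1mx -mulmxA hY mulmx1.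
  by rewrite eG2 !mulmxA.
have eE : E = (W' *m X) *m H *m (Y *m Z').
  have : W' *m G *m Z' = E by rewrite eG2 !mulmxA hW mul1mx -mulmxA hZ mulmx1.
  by rewrite eG !mulmxA.
have dH : \det H = (\det (X' *m W) * \det (Z *m Y')) * \det E.
  by rewrite {1}eH !(det_mulmx (_ *m _)); ring.
have dE : \det E = (\det (W' *m X) * \det (Y *m Z')) * \det H.
  by rewrite {1}eE !(det_mulmx (_ *m _)); ring.
have H0 : \det H != 0 by rewrite -unitfE -unitmxE.
have E0 : \det E != 0 by rewrite -unitfE -unitmxE.
move: dH dE; set u := _ * \det (Z *m Y'); set v := _ * \det (Y *m Z') => dH dE.
have uv : u * v = 1.
  by apply: (mulIf H0); rewrite mul1r -mulrA -dE -dH.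
have u0 : u != 0 by apply: contraNneq H0 => u0; rewrite dH u0 mul0r.
rewrite dH degM // (uS (y := v)) ?add0r //;
  by apply: (subringM rS); apply: mxover_det; rewrite //; apply: mxoverM.
Qed.

(* [L = [A B; -C D]] has transfer function [G = D + C A^-1 B = X H Y].  Then
   [L = [1 0; -f X] [A, B Y'; -X' C, X' D Y'] [1 e; 0 Y]] with
   [e = A^-1 B (1 - Y' Y)], [f = (1 - X X') C A^-1], and the middle factor has
   Schur complement [X' G Y' = H]. *)
Lemma delta_system p m n (A : 'M[K]_n) (B : 'M[K]_(n, m)) (C : 'M[K]_(p, n))
    (D : 'M[K]_(p, m)) r z :
  let G := D + C *m invmx A *m B in
  A \in unitmx ->
  (forall k (V : 'M[K]_(m, k)), mxover S V -> G *m V = 0 -> mxover S (invmx A *m B *m V)) ->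
  (forall k (U : 'M[K]_(k, p)), mxover S U -> U *m G = 0 -> mxover S (U *m C *m invmx A)) ->
  delta deg S G r z ->
  delta deg S (block_mx A B (- C) D) (n + r) (deg (\det A) + z).
Proof.
move=> G uA hB hC [X [X' [H [Y [Y' [[a b c d] hX hY eG [uH <-]]]]]]].
(* [Q] projects onto the right kernel of [G] and [P] onto its left kernel, so the two hypotheses
   apply to them and put [e] and [f] over [S]. *)
pose Q := 1%:M - Y' *m Y; pose P := 1%:M - X *m X'.
have GQ : G *m Q = 0.
  by rewrite mulmxBr mulmx1 eG -!mulmxA (mulmxA Y) hY mul1mx subrr.
have PG : P *m G = 0.
  by rewrite mulmxBl mul1mx eG !mulmxA -(mulmxA X X' X) hX mulmx1 subrr.
have sQ : mxover S Q by apply: mxoverB => //; [apply: mxover1|apply: mxoverM].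
have sP : mxover S P by apply: mxoverB => //; [apply: mxover1|apply: mxoverM].
pose e := invmx A *m B *m Q; pose f := P *m C *m invmx A.
have se : mxover S e by apply: hB.
have sf : mxover S f by apply: hC.
have X'P : X' *m P = 0 by rewrite mulmxBr mulmx1 mulmxA hX mul1mx subrr.
have X'f : X' *m f = 0 by rewrite !mulmxA X'P !mul0mx.
have DQ : D *m Q = - (C *m e).
  by apply/eqP; rewrite -addr_eq0 !mulmxA -mulmxDl; apply/eqP.
have PD : P *m D = - (f *m B).
  by apply/eqP; rewrite -addr_eq0 -!mulmxA -mulmxDr mulmxA; apply/eqP.
have Ae : A *m e = B *m Q by rewrite !mulmxA (mulmxV uA) mul1mx.
have fA : f *m A = P *m C by rewrite (mulmxKV uA).
have QE : B *m Q + B *m Y' *m Y = B by rewrite mulmxBr mulmx1 mulmxA subrK.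
exists (block_mx 1%:M 0 (- f) X), (block_mx 1%:M 0 0 X'),
  (block_mx A (B *m Y') (- (X' *m C)) (X' *m D *m Y')),
  (block_mx 1%:M e 0 Y), (block_mx 1%:M (- (e *m Y')) 0 Y').
split.
- split; apply: mxover_block => //; try exact: mxover0; try exact: mxover1.
    by apply: mxoverN.
  by apply: mxoverN => //; apply: mxoverM.
- rewrite mulmx_block !(mulmx0, mul0mx, mulmx1, mul1mx, addr0, add0r) mulmxN X'f oppr0 hX.
  by rewrite -scalar_mx_block.
- rewrite mulmx_block !(mulmx0, mul0mx, mulmx1, mul1mx, addr0, add0r) addNr hY.
  by rewrite -scalar_mx_block.
- have h21 : - f *m A + X *m - (X' *m C) = - C.
    rewrite mulNmx fA mulmxN -opprD; congr (- _).
    by rewrite mulmxA -mulmxDl subrK mul1mx.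
  rewrite !mulmx_block !(mulmx0, mul0mx, mulmx1, mul1mx, addr0, add0r) h21.
  congr block_mx; first by rewrite Ae QE.
  have -> : - f *m (B *m Y') = P *m D *m Y' by rewrite PD !mulNmx mulmxA.
  rewrite mulNmx -DQ !mulmxA -!mulmxDl subrK mul1mx.
  by rewrite mulmxBr mulmx1 mulmxA subrK.
- have eH : H = X' *m G *m Y'.
    by rewrite eG !mulmxA hX mul1mx -mulmxA hY mulmx1.
  have -> : block_mx A (B *m Y') (- (X' *m C)) (X' *m D *m Y') =
      block_mx 1%:M 0 (- (X' *m C *m invmx A)) 1%:M *m block_mx A (B *m Y') 0 H.
    rewrite mulmx_block !(mulmx0, mul0mx, mulmx1, mul1mx, addr0, add0r).
    congr block_mx; first by rewrite mulNmx (mulmxKV uA).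
    by rewrite eH /G mulmxDr mulmxDl mulNmx !mulmxA addrCA addNr addr0.
  move: (uA) (uH); rewrite !unitmxE det_mulmx det_lblock det_ublock !det1 !mul1r.
  move=> uA' uH'; split; first by rewrite unitrM uA'.
  by rewrite degM // -unitfE.
Qed.

End Delta.
End Generic.

(** * Degrees of rational functions *)

HB.instance Definition _ (F : fieldType) :=
  GRing.RMorphism.copy (@pr F) (@tofrac {poly F}).

Section Degree.
Variable F : fieldType.
Local Notation K := (ratF F).
Local Notation pr := (@pr F).
Local Notation lam := (@lam F).
Implicit Types (a b c : {poly F}) (x y z : K) (k l : int).

Lemma pr_eq0 a : (pr a == 0) = (a == 0).
Proof. exact: tofrac_eq0. Qed.

Lemma pr_inj : injective pr.
Proof. by move=> a b /eqP; rewrite tofrac_eq => /eqP. Qed.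

(** Numerator and denominator of a chosen representative, not assumed coprime; only the difference
    of their degrees is used as an invariant. *)
Definition num x : {poly F} := \n_(repr x).
Definition den x : {poly F} := \d_(repr x).

Lemma den_neq0 x : den x != 0.
Proof. exact: denom_ratioP. Qed.

Lemma num_den x : x = pr (num x) / pr (den x).
Proof.
apply: (mulIf (x := pr (den x))); first by rewrite pr_eq0 den_neq0.
rewrite divfK ?pr_eq0 ?den_neq0 //.
rewrite /num /den /Defs.pr; move: (repr x) (reprK x) => y <-.
unlock FracField.tofrac; rewrite -[LHS]FracField.pi_mul.
apply/eqmodP; rewrite /= FracField.equivfE /FracField.mulf.
by rewrite !numden_Ratio ?mulf_neq0 ?denom_ratioP ?oner_eq0 // !mulr1 mulrC.
Qed.

(** A size exceeds the degree by one; the two ones cancel for nonzero [x]. *)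
Definition rdeg x : int := (size (num x))%:Z - (size (den x))%:Z.

Lemma rdeg_div a b : a != 0 -> b != 0 ->
  rdeg (pr a / pr b) = (size a)%:Z - (size b)%:Z.
Proof.
move=> a0 b0; rewrite /rdeg; set x := pr a / pr b.
have x0 : x != 0 by rewrite mulf_neq0 ?invr_eq0 ?pr_eq0.
have n0 : num x != 0.
  by apply: contraNneq x0; rewrite [x in x == _]num_den => ->; rewrite rmorph0 mul0r.
have : num x * b = a * den x.
  apply: pr_inj; rewrite !rmorphM /=; apply/eqP.
  by rewrite -eqr_div ?pr_eq0 ?den_neq0 // -num_den.
move/(congr1 (fun u : {poly F} => size u)); rewrite !size_mul ?den_neq0 //.
move: (den_neq0 x) n0 a0 b0; rewrite -!size_poly_gt0.
move: (size (num x)) (size (den x)) (size a) (size b); lia.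
Qed.

Lemma num_neq0 x : x != 0 -> num x != 0.
Proof.
move=> x0; apply: contraNneq x0; rewrite [x in x == _]num_den => ->.
by rewrite rmorph0 mul0r.
Qed.

Lemma rdegM x y : x != 0 -> y != 0 -> rdeg (x * y) = rdeg x + rdeg y.
Proof.
move=> x0 y0; rewrite [x in LHS]num_den [y in LHS]num_den mulf_div -!rmorphM /=.
rewrite rdeg_div ?mulf_neq0 ?num_neq0 ?den_neq0 // /rdeg.
rewrite !size_mul ?num_neq0 ?den_neq0 //.
move: (num_neq0 x0) (num_neq0 y0) (den_neq0 x) (den_neq0 y).
rewrite -!size_poly_gt0.
by move: (size (num x)) (size (den x)) (size (num y)) (size (den y)); lia.
Qed.

Lemma rdeg_pr a : a != 0 -> rdeg (pr a) = (pdeg a)%:Z.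
Proof.
move=> a0; rewrite -[pr a]divr1 -(rmorph1 pr) rdeg_div ?oner_eq0 //.
by move: a0; rewrite size_poly1 /pdeg -size_poly_gt0; move: (size a); lia.
Qed.

Lemma rdeg1 : rdeg 1 = 0.
Proof. exact: deg_one rdegM. Qed.

Lemma rdegV x : x != 0 -> rdeg x^-1 = - rdeg x.
Proof.
move=> x0; have := rdegM x0 (invr_neq0 x0).
by rewrite divff // rdeg1; lia.
Qed.

Lemma lam_neq0 : lam != 0.
Proof. by rewrite pr_eq0 polyX_eq0. Qed.

Lemma rdegX x (n : nat) : x != 0 -> rdeg (x ^+ n) = rdeg x * n%:Z.
Proof. exact: deg_expr rdegM _ _. Qed.

Lemma lamz_neq0 k : lam ^ k != 0.
Proof. by rewrite expfz_neq0 // lam_neq0. Qed.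

Lemma rdeg_lam k : rdeg (lam ^ k) = k.
Proof.
have lX n : rdeg (lam ^+ n) = n%:Z.
  rewrite rdegX ?lam_neq0 // rdeg_pr ?polyX_eq0 // /pdeg size_polyX; lia.
case: k => n; first exact: lX.
by rewrite NegzE -exprnN rdegV ?expf_neq0 ?lam_neq0 // lX.
Qed.

(* [rdeg 0] is junk, so a degree bound treats [0] separately. *)
Definition dle k x : Prop := x = 0 \/ rdeg x <= k.

Lemma dle_frac k a b : b != 0 -> dle k (pr a / pr b) <->
  (a = 0 \/ (size a)%:Z <= (size b)%:Z + k).
Proof.
move=> b0; have [->|a0] := eqVneq a 0.
  by split=> _; left; rewrite ?rmorph0 ?mul0r.
split=> -[].
- by move/eqP; rewrite mulf_eq0 invr_eq0 !pr_eq0 (negPf a0) (negPf b0).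
- by rewrite rdeg_div // => ?; right; lia.
- by move=> e; rewrite e eqxx in a0.
- by rewrite /dle rdeg_div // => ?; right; lia.
Qed.

Lemma dle0 k : dle k 0. Proof. by left. Qed.

Lemma dleN k x : dle k x -> dle k (- x).
Proof.
rewrite [x]num_den -mulNr -rmorphN; move/(dle_frac _ _ (den_neq0 _)) => h.
apply/dle_frac; first exact: den_neq0.
by rewrite size_polyN; case: h => [->|h]; [left; rewrite oppr0|right].
Qed.

Lemma dleD k x y : dle k x -> dle k y -> dle k (x + y).
Proof.
have [->|x0] := eqVneq x 0; first by rewrite add0r.
have [->|y0] := eqVneq y 0; first by rewrite addr0.
rewrite [x]num_den [y]num_den; move: (num_neq0 x0) (num_neq0 y0).
move: (num x) (den x) (num y) (den y) (den_neq0 x) (den_neq0 y) => a b c d b0 d0.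
move=> a0 c0 /dle_frac-/(_ b0) hx /dle_frac-/(_ d0) hy.
rewrite addf_div ?pr_eq0 // -!rmorphM -rmorphD /=.
apply/dle_frac; rewrite ?mulf_neq0 //.
have [|nz] := eqVneq (a * d + c * b) 0; [by left|right].
have := size_polyD (a * d) (c * b); rewrite !size_mul // => h.
case: hx => [e|hx]; first by rewrite e eqxx in a0.
case: hy => [e|hy]; first by rewrite e eqxx in c0.
move: a0 b0 c0 d0 h hx hy; rewrite -!size_poly_gt0.
by move: (size _) (size a) (size b) (size c) (size d); lia.
Qed.

Lemma dleM k l x y : dle k x -> dle l y -> dle (k + l) (x * y).
Proof.
case=> [->|hx]; first by rewrite mul0r; left.
case=> [->|hy]; first by rewrite mulr0; left.
have [->|x0] := eqVneq x 0; first by rewrite mul0r; left.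
have [->|y0] := eqVneq y 0; first by rewrite mulr0; left.
by right; rewrite rdegM // lerD.
Qed.

Lemma dle_trans k l x : k <= l -> dle k x -> dle l x.
Proof. by move=> kl [->|h]; [left|right; apply: le_trans h kl]. Qed.

Lemma dle_pr a k : (pdeg a)%:Z <= k -> dle k (pr a).
Proof.
by have [->|a0] := eqVneq a 0; [rewrite rmorph0; left|right; rewrite rdeg_pr].
Qed.

Lemma dle_lam k : dle k (lam ^ k).
Proof. by right; rewrite rdeg_lam. Qed.

Lemma proper_dle x : Defs.proper x <-> dle 0 x.
Proof.
split=> [[a [b [b0 -> ab]]]|].
  by apply/dle_frac => //; right; rewrite addr0.
rewrite [x]num_den => /dle_frac-/(_ (den_neq0 x)) [->|h].
  by exists 0, 1; rewrite oner_eq0 rmorph0 mul0r rmorph1 mul0r size_poly0.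
by exists (num x), (den x); split => //; [exact: den_neq0|rewrite addr0 in h].
Qed.

Lemma strictly_proper_dle x : strictly_proper x <-> dle (- 1) x.
Proof.
split=> [[a [b [b0 -> ab]]]|].
  by apply/dle_frac => //; right; move: (size a) (size b) ab; lia.
rewrite [x]num_den => /dle_frac-/(_ (den_neq0 x)) [->|h].
  by exists 0, 1; rewrite oner_eq0 rmorph0 mul0r rmorph1 mul0r size_poly0 size_poly1.
exists (num x), (den x); split => //; first exact: den_neq0.
by move: (size _) (size _) h; lia.
Qed.

(* [x = pr a] forces [a = num x %/ den x], which makes this equation an
   existential-free way to say that [x] is a polynomial. *)
Definition polyS x : Prop := x = pr (num x %/ den x).
Definition propS : K -> Prop := dle 0.

Lemma polyS_pr a : polyS (pr a).
Proof.
rewrite /polyS; congr pr.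
suff -> : num (pr a) = a * den (pr a) by rewrite mulpK ?den_neq0.
by apply: pr_inj; rewrite rmorphM /= [X in X * _]num_den divfK ?pr_eq0 ?den_neq0.
Qed.

Lemma polySP x : polyS x <-> exists a, x = pr a.
Proof. by split=> [h|[a ->]]; [exists (num x %/ den x)|exact: polyS_pr]. Qed.

Lemma poly_subring : subring polyS.
Proof.
by split=> [|x y -> ->|x y -> ->]; rewrite -?rmorphB -?rmorphM -?(rmorph1 pr);
  apply: polyS_pr.
Qed.

Lemma prop_subring : subring propS.
Proof.
split=> [|x y hx hy|x y hx hy]; first by right; rewrite rdeg1.
  by apply: dleD => //; apply: dleN.
by rewrite /propS -[0]addr0; apply: dleM.
Qed.

Lemma mxover_prmx m n (P : 'M[{poly F}]_(m, n)) : mxover polyS (prmx P).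
Proof. by move=> i j; rewrite mxE; apply: polyS_pr. Qed.

Lemma polyS_unit x y : polyS x -> polyS y -> x * y = 1 -> rdeg x = 0.
Proof.
move=> -> ->; move: (_ %/ _) (_ %/ _) => b a ab.
have a0 : a != 0.
  by apply/eqP=> e; move/eqP: ab; rewrite e rmorph0 mul0r eq_sym oner_eq0.
have b0 : b != 0.
  by apply/eqP=> e; move/eqP: ab; rewrite e rmorph0 mulr0 eq_sym oner_eq0.
move/(congr1 rdeg): ab; rewrite rdegM ?pr_eq0 // rdeg1 !rdeg_pr //; lia.
Qed.

Lemma propS_unit x y : propS x -> propS y -> x * y = 1 -> rdeg x = 0.
Proof.
move=> hx hy xy.
have x0 : x != 0 by apply/eqP=> e; move/eqP: xy; rewrite e mul0r eq_sym oner_eq0.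
have y0 : y != 0 by apply/eqP=> e; move/eqP: xy; rewrite e mulr0 eq_sym oner_eq0.
move/(congr1 rdeg): xy; rewrite rdegM // rdeg1.
case: hx => [/eqP|hx]; first by rewrite (negPf x0).
case: hy => [/eqP|hy]; first by rewrite (negPf y0).
lia.
Qed.

End Degree.

(** * The residue at infinity *)

Definition cst (F : fieldType) : F -> ratF F := @pr F \o polyC.
HB.instance Definition _ (F : fieldType) :=
  GRing.RMorphism.copy (@cst F) (@pr F \o polyC).

Section Infinity.
Variable F : fieldType.
Local Notation K := (ratF F).
Local Notation pr := (@pr F).
Local Notation lam := (@lam F).
Local Notation propS := (@propS F).

Lemma rdeg_cst (c : F) : c != 0 -> rdeg (cst c) = 0.
Proof. by move=> c0; rewrite rdeg_pr ?polyC_eq0 // /pdeg size_polyC c0. Qed.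

Lemma propS_cst (c : F) : propS (cst c).
Proof. by apply: dle_pr; rewrite /pdeg size_polyC; case: (c != 0). Qed.

Lemma mxover_cst m n (C : 'M[F]_(m, n)) : mxover propS (map_mx (@cst F) C).
Proof. by move=> i j; rewrite mxE; apply: propS_cst. Qed.

Lemma dleM0l k (x y : K) : propS x -> dle k y -> dle k (x * y).
Proof. by move=> hx hy; rewrite -[k]add0r; apply: dleM. Qed.

Lemma dleM0r k (x y : K) : dle k x -> propS y -> dle k (x * y).
Proof. by move=> hx hy; rewrite -[k]addr0; apply: dleM. Qed.

(** The strictly proper functions form an ideal of the proper ones, so congruence modulo this ideal
    passes through the sums and products of the Leibniz formula. *)
Lemma det_congr n (A B : 'M[K]_n) : mxover propS A -> mxover propS B ->
  mxover (dle (-1)) (A - B) -> dle (-1) (\det A - \det B).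
Proof.
move=> hA hB hAB.
pose R (x y : K) := [/\ propS x, propS y & dle (-1) (x - y)].
have pS := prop_subring F.
have RM x x' y y' : R x x' -> R y y' -> R (x * y) (x' * y').
  move=> [a b c] [d e f]; split; try exact: (subringM pS).
  rewrite (_ : _ - _ = (x - x') * y + x' * (y - y')); last by ring.
  by apply: dleD; [apply: dleM0r|apply: dleM0l].
have RD x x' y y' : R x x' -> R y y' -> R (x + y) (x' + y').
  move=> [a b c] [d e f]; split; try exact: subringD.
  by rewrite opprD addrACA; apply: dleD.
have Rrefl x : propS x -> R x x by move=> h; split=> //; rewrite subrr; left.
suff [] : R (\det A) (\det B) by [].
apply: (big_ind2 R) => [|? ? ? ? |s _]; [by apply: Rrefl; left|exact: RD|].
apply: (RM); last apply: (big_ind2 R) => [|? ? ? ? |i _].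
- apply: Rrefl; case: (odd_perm s); rewrite ?expr0 ?expr1.
    by apply: subringN => //; apply: (subring1 pS).
  exact: (subring1 pS).
- by apply: Rrefl; apply: (subring1 pS).
- exact: RM.
- by split=> //; have := hAB i (s i); rewrite !mxE.
Qed.

Lemma dle_mulmxl m n p k (A : 'M[K]_(m, n)) (B : 'M[K]_(n, p)) :
  mxover propS A -> mxover (dle k) B -> mxover (dle k) (A *m B).
Proof.
move=> hA hB i j; rewrite mxE; apply: big_ind; [by left|exact: dleD|].
by move=> u _; apply: dleM0l.
Qed.

Lemma dle_mulmxr m n p k (A : 'M[K]_(m, n)) (B : 'M[K]_(n, p)) :
  mxover (dle k) A -> mxover propS B -> mxover (dle k) (A *m B).
Proof.
move=> hA hB i j; rewrite mxE; apply: big_ind; [by left|exact: dleD|].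
by move=> u _; apply: dleM0r.
Qed.

(** The hypothesis, which recurs below, expresses that [M] takes the value [C] at infinity. *)
Lemma near_cst_over m n (M : 'M[K]_(m, n)) (C : 'M[F]_(m, n)) :
  mxover (dle (-1)) (M - map_mx (@cst F) C) -> mxover propS M.
Proof.
move=> h i j; rewrite -[M i j](subrK (cst (C i j))).
apply: dleD; last exact: propS_cst.
by apply: (dle_trans (k := -1)) => //; have := h i j; rewrite !mxE.
Qed.

Lemma near_cst_det n (M : 'M[K]_n) (C : 'M[F]_n) :
  mxover (dle (-1)) (M - map_mx (@cst F) C) -> dle (-1) (\det M - cst (\det C)).
Proof.
move=> h; rewrite -det_map_mx; apply: det_congr => //; last exact: mxover_cst.
exact: near_cst_over h.
Qed.

(** The determinant takes the nonzero value [det C] at infinity, so it has degree exactly 0 and is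
    invertible among the proper functions. *)
Lemma near_cst_unit n (M : 'M[K]_n) (C : 'M[F]_n) : C \in unitmx ->
  mxover (dle (-1)) (M - map_mx (@cst F) C) ->
  [/\ M \in unitmx, rdeg (\det M) = 0 & mxover propS (invmx M)].
Proof.
rewrite unitmxE unitfE => uC h.
have hM := near_cst_over h.
have nd : ~ dle (-1) (\det M).
  move=> hd; have [/eqP|] : dle (-1) (cst (\det C)).
  - rewrite -[cst _](subKr (\det M)); apply: dleD => //; apply: dleN.
    exact: near_cst_det.
  - by rewrite fmorph_eq0 (negPf uC).
  - by rewrite rdeg_cst.
have d0 : \det M != 0 by apply/eqP=> e; apply: nd; rewrite e; left.
have dd : rdeg (\det M) = 0.
  have [/eqP|d1] := mxover_det (prop_subring F) hM; first by rewrite (negPf d0).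
  have [d2|] := leP (rdeg (\det M)) (-1); first by case: nd; right.
  by move: d1; move: (rdeg _) => k; lia.
have uM : M \in unitmx by rewrite unitmxE unitfE.
split=> //; apply: mxover_invmx => //; first exact: prop_subring.
by right; rewrite rdegV // dd.
Qed.

Lemma near_cst_inv n (M : 'M[K]_n) (C : 'M[F]_n) : C \in unitmx ->
  mxover (dle (-1)) (M - map_mx (@cst F) C) ->
  mxover (dle (-1)) (invmx M - map_mx (@cst F) (invmx C)).
Proof.
move=> uC h; have [uM _ hi] := near_cst_unit uC h.
have uC' : map_mx (@cst F) C \in unitmx by rewrite map_unitmx.
rewrite map_invmx (_ : _ - _ =
  invmx M *m (- (M - map_mx (@cst F) C)) *m invmx (map_mx (@cst F) C)).
  apply: dle_mulmxr; last by rewrite -map_invmx; apply: mxover_cst.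
  apply: dle_mulmxl; first exact: hi.
  by move=> i j; rewrite mxE; apply: dleN; apply: h.
by rewrite opprB mulmxBr mulmxBl (mulVmx uM) mul1mx (mulmxK uC').
Qed.

Lemma near_cstM m n p (M : 'M[K]_(m, n)) (N : 'M[K]_(n, p)) C E :
  mxover (dle (-1)) (M - map_mx (@cst F) C) -> mxover (dle (-1)) (N - map_mx (@cst F) E) ->
  mxover (dle (-1)) (M *m N - map_mx (@cst F) (C *m E)).
Proof.
move=> hM hN; rewrite map_mxM (_ : _ - _ =
  (M - map_mx (@cst F) C) *m N + map_mx (@cst F) C *m (N - map_mx (@cst F) E)).
  move=> i j; rewrite mxE; apply: dleD.
    by apply: dle_mulmxr => //; apply: near_cst_over hN.
  by apply: dle_mulmxl => //; apply: mxover_cst.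
by rewrite mulmxBr mulmxBl addrA subrK.
Qed.

End Infinity.

(** * Unimodular reduction of polynomial matrices *)

Section Unimodular.
Variable F : fieldType.
Local Notation K := (ratF F).
Local Notation pr := (@pr F).
Local Notation R := {poly F}.

(** The first column of [W] holds the Bezout coefficients of [a] and [b], the second one their
    cofactors [- b / g] and [a / g]; this has determinant 1. For [a = b = 0] there are no cofactors
    and the identity serves. *)
Lemma bezout_col2 (a b : R) : exists (W : 'M[R]_(1 + 1)) (g : R),
  W \in unitmx /\ row_mx a%:M b%:M *m W = row_mx g%:M 0.
Proof.
have [/andP[/eqP-> /eqP->]|ab0] := boolP ((a == 0) && (b == 0)).
  by exists 1%:M, 0; rewrite unitmx1 mulmx1 raddf0.
have [[u v] /= huv] := Bezoutp a b.
set g := u * a + v * b in huv.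
have g0 : g != 0.
  by rewrite -size_poly_eq0 (eqp_size huv) size_poly_eq0 gcdp_eq0.
have /dvdpP[a' ea] : g %| a by rewrite (eqp_dvdl _ huv) dvdp_gcdl.
have /dvdpP[b' eb] : g %| b by rewrite (eqp_dvdl _ huv) dvdp_gcdr.
have e1 : u * a' + v * b' = 1.
  apply: (mulIf g0); rewrite mul1r mulrDl -!mulrA -ea -eb; exact: erefl.
pose W : 'M[R]_(1 + 1) := block_mx u%:M (- b')%:M v%:M a'%:M.
pose V : 'M[R]_(1 + 1) := block_mx a'%:M b'%:M (- v)%:M u%:M.
exists W, g; split.
  suff VW : V *m W = 1%:M by case: (mulmx1_unit VW).
  rewrite mulmx_block -!scalar_mxM -!raddfD /= [1%:M]scalar_mx_block.
  have z : 0 = (0 : R)%:M :> 'M_1 by rewrite raddf0.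
  congr block_mx; rewrite ?z; congr (_%:M).
  - by rewrite -e1; ring.
  - by ring.
  - by ring.
  - by rewrite -e1; ring.
rewrite mul_row_block -!scalar_mxM -!raddfD /=; congr row_mx.
  by congr (_%:M); rewrite /g; ring.
by rewrite -(raddf0 (@scalar_mx _ 1)); congr (_%:M); rewrite ea eb; ring.
Qed.

(** By induction the tail is reduced to a single entry, which the 2 by 2 Bezout matrix then merges
    with the leading one. *)
Lemma row_reduce k (x : 'rV[R]_(1 + k)) : exists (W : 'M[R]_(1 + k)) (g : R),
  W \in unitmx /\ x *m W = row_mx g%:M 0.
Proof.
elim: k x => [|k IH] x.
  exists 1%:M, (x 0 0); rewrite unitmx1 mulmx1; split=> //.
  rewrite -[LHS]hsubmxK (thinmx0 (rsubmx x)); congr row_mx.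
  by rewrite [LHS]mx11_scalar; congr (_%:M); rewrite mxE; congr (x _ _); apply: val_inj.
rewrite -[k.+1]/(1 + k)%N in x *.
have [W' [g' [uW' e']]] := IH (rsubmx x).
pose x0 := lsubmx x 0 0.
have [M [g [uM e]]] := bezout_col2 x0 g'.
pose N : 'M[R]_(1 + 1 + k) := block_mx M 0 0 1%:M.
exists (block_mx 1%:M 0 0 W' *m (N : 'M_(1 + (1 + k)))), g; split.
  rewrite unitmx_mul; apply/andP; split; rewrite unitmxE.
    by rewrite det_ublock det1 mul1r -unitmxE.
  change (\det N \is a GRing.unit).
  by rewrite det_ublock det1 mulr1 -unitmxE.
rewrite mulmxA -{1}[x]hsubmxK mul_row_block.
rewrite !(mulmx0, mul0mx, mulmx1, mul1mx, addr0, add0r) e' [lsubmx x]mx11_scalar -/x0.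
rewrite row_mxA castmx_id.
have eN : row_mx (row_mx x0%:M g'%:M) (0 : 'rV_k) *m N =
    row_mx (row_mx g%:M 0) 0.
  by rewrite mul_row_block !(mulmx0, mul0mx, mulmx1, mul1mx, addr0, add0r) e.
apply: (etrans eN); rewrite -[in RHS]row_mx0 [in RHS]row_mxA.
by rewrite castmx_id.
Qed.

Lemma clear_den m n (M : 'M[K]_(m, n)) :
  exists (c : R) (P : 'M[R]_(m, n)), c != 0 /\ pr c *: M = prmx P.
Proof.
pose d (t : 'I_m * 'I_n) := den (M t.1 t.2).
exists (\prod_t d t), (\matrix_(i, j) (num (M i j) * \prod_(t | t != (i, j)) d t)).
split; first by rewrite prodf_seq_neq0; apply/allP=> t _ /=; apply: den_neq0.
apply/matrixP=> i j; rewrite !mxE (bigD1 (i, j)) //=; set q := \prod_(t | _) _.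
rewrite !rmorphM /= mulrAC /d /=; congr (_ * _).
by rewrite [X in _ * X]num_den mulrC divfK // pr_eq0 den_neq0.
Qed.

Lemma prmx_inj m n : injective (@prmx F m n).
Proof.
move=> A B /matrixP e; apply/matrixP=> i j; apply: pr_inj.
by have := e i j; rewrite !mxE.
Qed.

Lemma prmx_tr m n (A : 'M[R]_(m, n)) : prmx A^T = (prmx A)^T.
Proof. by rewrite /prmx map_trmx. Qed.

Lemma prmxM m n p (A : 'M[R]_(m, n)) (B : 'M[R]_(n, p)) :
  prmx (A *m B) = prmx A *m prmx B.
Proof. exact: map_mxM. Qed.

Lemma prmx_unit n (A : 'M[R]_n) : A \in unitmx -> prmx A \in unitmx.
Proof. by rewrite !unitmxE det_map_mx => /(rmorph_unit pr). Qed.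

Lemma prmx_inv n (A : 'M[R]_n) : A \in unitmx -> prmx (invmx A) = invmx (prmx A).
Proof.
move=> uA; apply: (can_inj (mulKmx (prmx_unit uA))).
by rewrite /= (mulmxV (prmx_unit uA)) -prmxM (mulmxV uA); exact: map_mx1.
Qed.

Lemma left_dependence m n (P : 'M[R]_(m, n)) : (\rank (prmx P) < m)%N ->
  exists x : 'rV[R]_m, x != 0 /\ x *m P = 0.
Proof.
move=> h; have : kermx (prmx P) != 0.
  by rewrite -mxrank_eq0 mxrank_ker subn_eq0 -ltnNge.
case/rowV0Pn=> v /sub_kermxP hv v0.
have [c [x [c0 hx]]] := clear_den v; exists x; split.
  apply: contraNneq v0 => x0; move: hx; rewrite x0 /prmx map_mx0 => /eqP.
  by rewrite scaler_eq0 pr_eq0 (negPf c0).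
by apply: prmx_inj; rewrite prmxM -hx -scalemxAl hv scaler0 /prmx map_mx0.
Qed.

(** A polynomial relation [x P = 0] with [x W = (g, 0)] and [g] nonzero forces the first row of
    [W^-1 P] to vanish; the remaining rows are treated by induction. *)
Lemma zero_rows k r n (P : 'M[R]_(k + r, n)) : (\rank (prmx P) <= r)%N ->
  exists2 W : 'M[R]_(k + r), W \in unitmx & usubmx (W *m P) = 0.
Proof.
elim: k P => [|k IH] P hP.
  by exists 1%:M; rewrite ?unitmx1 ?flatmx0.
have [|x [x0 xP]] := left_dependence (P := P).
  by apply: (leq_ltn_trans hP); rewrite addSn ltnS leq_addl.
have [W [g [uW e]]] := row_reduce (x : 'rV_(1 + (k + r))).
have g0 : g != 0.
  apply: contraNneq x0 => g0; apply/eqP.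
  rewrite -[LHS](mulmxK (uW : (W : 'M_(k.+1 + r)) \in unitmx)) [X in X *m _]e g0.
  by rewrite raddf0 row_mx0 mul0mx.
pose Q : 'M[R]_(1 + (k + r), n) := invmx W *m P.
have Q0 : usubmx Q = 0.
  have : row_mx g%:M 0 *m col_mx (usubmx Q) (dsubmx Q) = 0.
    by rewrite vsubmxK -e /Q mulmxA (mulmxK uW).
  rewrite mul_row_col mul0mx addr0 mul_scalar_mx => /matrixP h.
  apply/matrixP=> i j; apply/eqP; move: (h i j); rewrite !mxE => /eqP.
  by rewrite mulf_eq0 (negPf g0).
have hD : (\rank (prmx (dsubmx Q)) <= r)%N.
  apply: leq_trans hP.
  have -> : prmx (dsubmx Q) = dsubmx (prmx (invmx W)) *m (prmx P : 'M_(1 + (k + r), n)).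
    by rewrite mul_dsub_mx -prmxM /prmx map_dsubmx.
  exact: mxrankM_maxr.
have [W' uW' hW'] := IH _ hD.
have uV : block_mx (1%:M : 'M_1) 0 0 W' *m invmx W \in unitmx.
  rewrite unitmx_mul unitmx_inv uW andbT unitmxE det_ublock det1 mul1r.
  by rewrite -unitmxE.
have e3 : block_mx (1%:M : 'M_1) 0 0 W' *m invmx W *m (P : 'M_(1 + (k + r), n)) =
    col_mx 0 (W' *m dsubmx Q).
  rewrite -mulmxA -/Q -{1}[Q]vsubmxK Q0 mul_block_col.
  by rewrite !(mulmx0, mul0mx, mulmx1, mul1mx, addr0, add0r).
exists (block_mx 1%:M 0 0 W' *m invmx W); first exact: uV.
move: e3; rewrite -[W' *m _]vsubmxK hW' col_mxA castmx_id col_mx0 => e3.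
by apply: (etrans (congr1 (fun M : 'M_(k.+1 + r, n) => usubmx M) e3)); apply: col_mxKu.
Qed.

End Unimodular.

(** * Minimal bases *)

Section ColumnReduction.
Variable F : fieldType.
Local Notation K := (ratF F).
Local Notation pr := (@pr F).
Local Notation lam := (@lam F).
Local Notation R := {poly F}.
Local Notation propS := (@propS F).
Local Notation polyS := (@polyS F).

Definition cdeg m k (N : 'M[R]_(m, k)) (j : 'I_k) : nat := (\max_(i < m) pdeg (N i j))%N.

(** The leading column coefficient matrix; [N] is column reduced when this has full column rank. *)
Definition hc m k (N : 'M[R]_(m, k)) : 'M[F]_(m, k) :=
  \matrix_(i, j) (N i j)`_(cdeg N j).

Lemma size_cdeg m k (N : 'M[R]_(m, k)) i j : (size (N i j) <= (cdeg N j).+1)%N.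
Proof.
have : (pdeg (N i j) <= cdeg N j)%N by apply: (leq_bigmax (F := fun i => pdeg (N i j))).
by rewrite /pdeg; move: (size _) (cdeg _ _) => a b; lia.
Qed.

(* A kernel vector [v] of the leading coefficient matrix [hc N], scaled so that
   [v j0 = 1] at a column [j0] of maximal degree in its support, cancels the
   leading terms of column [j0]. *)
Lemma reduction_step m k (N : 'M[R]_(m, k)) :
  \rank (prmx N) = k -> (\rank (hc N) < k)%N ->
  exists2 T : 'M[R]_k, T \in unitmx & (col_total_deg (N *m T) < col_total_deg N)%N.
Proof.
move=> rN rh.
have : kermx (hc N)^T != 0 by rewrite -mxrank_eq0 mxrank_ker mxrank_tr subn_eq0 -ltnNge.
case/rowV0Pn=> v0 /sub_kermxP hv0 nv0.
have [j1 vj1] : exists j, v0 0 j != 0.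
  by apply/existsP; apply: contraR nv0; rewrite negb_exists => /forallP h;
    apply/eqP/rowP=> j; rewrite mxE; apply/eqP; rewrite -[_ == _]negbK h.
have [j0 vj0 max0] := @arg_maxnP _ j1 (fun j => v0 0 j != 0) (cdeg N) vj1.
pose v : 'cV[F]_k := (v0 0 j0)^-1 *: v0^T.
have hv : hc N *m v = 0.
  by rewrite -scalemxAr -[X in _ *: X]trmxK trmx_mul trmxK hv0 trmx0 scaler0.
have v1 : v j0 0 = 1 by rewrite !mxE mulVf.
have vmax u : v u 0 != 0 -> (cdeg N u <= cdeg N j0)%N.
  rewrite !mxE => h; apply: max0; by apply: contraNneq h => ->; rewrite mulr0.
pose t u : R := (v u 0)%:P * 'X^(cdeg N j0 - cdeg N u).
have t1 : t j0 = 1 by rewrite /t v1 subnn expr0 mulr1.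
pose w : 'cV[R]_k := \col_u (if u == j0 then 0 else t u).
pose e : 'rV[R]_k := delta_mx 0 j0.
have ew : e *m w = 0.
  by rewrite -rowE; apply/matrixP=> a b; rewrite !mxE eqxx.
(* This adds to column [j0] the multiples [t u] of the other columns. As [e w = 0], the inverse is
   [1 - w e]. *)
pose T : 'M[R]_k := 1%:M + w *m e.
have uT : T \in unitmx.
  suff h : T *m (1%:M - w *m e) = 1%:M by case: (mulmx1_unit h).
  rewrite mulmxBr mulmx1 mulmxDl mul1mx -mulmxA (mulmxA e) ew mul0mx mulmx0 addr0.
  by rewrite addrK.
have NTj i j : j != j0 -> (N *m T) i j = N i j.
  move=> jj; rewrite mulmxDr mulmx1 mulmxA mxE -[RHS]addr0; congr (_ + _).
  by rewrite mxE big1 // => u _; rewrite [e]lock mxE -lock mxE (negPf jj) andbF mulr0.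
have NT0 i : (N *m T) i j0 = \sum_u N i u * t u.
  rewrite mulmxDr mulmx1 mulmxA mxE [X in _ + X]mxE big_ord1 [e _ _]mxE !eqxx mulr1.
  rewrite [X in _ + X]mxE (bigD1 j0) //= [w _ _]mxE eqxx mulr0 add0r.
  rewrite [RHS](bigD1 j0) //= t1 mulr1; congr (_ + _).
  by apply: eq_bigr => u uj; rewrite [w _ _]mxE (negPf uj).
(* The size bound says that the degree is below [cdeg N j0]: the coefficient in that degree is an
   entry of [hc N *m v = 0]. *)
have szq i : (size ((N *m T) i j0) <= cdeg N j0)%N.
  apply/leq_sizeP=> d hd; rewrite NT0 coef_sum.
  have -> : \sum_u (N i u * t u)`_d =
      \sum_u (if d == cdeg N j0 then hc N i u * v u 0 else 0).
    apply: eq_bigr => u _; rewrite /t mulrA coefMXn coefMC [hc _ _ _]mxE.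
    have [->|vu] := eqVneq (v u 0) 0; first by rewrite !mulr0 !if_same.
    have cu := vmax u vu.
    have -> : (d < cdeg N j0 - cdeg N u)%N = false by lia.
    case: eqP => [->|/eqP dd]; first by rewrite subKn.
    rewrite nth_default ?mul0r //; apply: leq_trans (size_cdeg N i u) _; lia.
  case: eqP => _; last by rewrite big1.
  by move/matrixP: hv => /(_ i 0); rewrite !mxE.
(* If [cdeg N j0] were 0 the new column would be zero, against the rank. This matters because
   [pdeg 0 = 0] would hide the drop in degree. *)
have c0 : (0 < cdeg N j0)%N.
  rewrite lt0n; apply/eqP=> c0.
  have : row_full (prmx (N *m T)).
    by rewrite /row_full prmxM mxrankMfree ?rN // row_free_unit prmx_unit.
  case/row_fullP=> B /matrixP /(_ j0 j0)/eqP; rewrite !mxE eqxx big1 ?(eq_sym 0) ?oner_eq0 //.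
  move=> u _; rewrite [prmx _ _ _]mxE.
  by move: (szq u); rewrite c0 leqn0 size_poly_eq0 => /eqP->; rewrite rmorph0 mulr0.
exists T => //; rewrite /col_total_deg (bigD1 j0) //= [ltnRHS](bigD1 j0) //=.
rewrite -addSn leq_add //; last first.
  by apply: leq_sum => j jj; apply: eq_leq; apply: eq_bigr => i _; rewrite NTj.
rewrite -/(cdeg N j0) -(prednK c0) ltnS; apply/bigmax_leqP => i _.
by have := szq i; rewrite /pdeg; move: (size _) (cdeg _ _) => a b; lia.
Qed.

(** Descent on the total column degree, which a reduction step lowers as long as the leading
    coefficient matrix is rank deficient. *)
Lemma column_reduction m k (N : 'M[R]_(m, k)) : \rank (prmx N) = k ->
  exists2 T : 'M[R]_k, T \in unitmx & \rank (hc (N *m T)) = k.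
Proof.
have [d] := ubnP (col_total_deg N); elim: d N => // d IH N hd rN.
have [rh|rh] := ltnP (\rank (hc N)) k; last first.
  exists 1%:M; first exact: unitmx1.
  by rewrite mulmx1; apply/eqP; rewrite eqn_leq rank_leq_col.
have [T uT hT] := reduction_step rN rh.
have [||T' uT' h] := IH (N *m T).
- exact: leq_trans hT _.
- by rewrite prmxM mxrankMfree // row_free_unit prmx_unit.
by exists (T *m T'); rewrite ?unitmx_mul ?uT // mulmxA.
Qed.

Lemma basis_completion k r (H : 'M[F]_(k + r, k)) : \rank H = k ->
  exists C : 'M[F]_(k + r, r), row_mx H C \in unitmx.
Proof.
move=> rH; exists (col_ebase H *m col_mx 0 1%:M).
have {1}-> : H = col_ebase H *m (col_mx 1%:M 0 *m row_ebase H).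
  by rewrite -{1}[H]mulmx_ebase rH pid_mx_col mulmxA.
rewrite -mul_mx_row mul_col_mx mul1mx mul0mx -block_mxEh unitmx_mul col_ebase_unit /=.
by rewrite unitmxE det_ublock det1 mulr1 -unitmxE row_ebase_unit.
Qed.

(** Zero rows of a unimodular multiple of the transpose are kernel columns of [G]. Column reduction
    mixes only these [k] columns, so the whole matrix stays unimodular. *)
Lemma kernel_basis p k r (G : 'M[K]_(p, k + r)) : \rank G = r ->
  exists U : 'M[R]_(k + r),
    [/\ U \in unitmx, G *m prmx (lsubmx U) = 0 & \rank (hc (lsubmx U)) = k].
Proof.
move=> rG; have [c [P [c0 eP]]] := clear_den G^T.
have c0' : pr c != 0 by rewrite pr_eq0.
have [|W uW hW] := zero_rows (P := P).
  by rewrite -eP mxrank_scale_nz // mxrank_tr rG.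
have e1 : lsubmx W^T = (usubmx W)^T by rewrite trmx_usub.
have GN1 : G *m prmx (lsubmx W^T) = 0.
  apply: trmx_inj; rewrite trmx_mul trmx0 e1 /prmx map_trmx trmxK.
  apply: (scalerI c0').
  by rewrite scaler0 scalemxAr eP -prmxM mul_usub_mx hW /prmx map_mx0.
have uWt : W^T \in unitmx by rewrite unitmx_tr.
have rN1 : \rank (prmx (lsubmx W^T)) = k.
  apply/eqP; rewrite eqn_leq rank_leq_col /=.
  have e : prmx (usubmx (invmx W^T)) *m prmx (lsubmx W^T) = 1%:M.
    rewrite -prmxM mul_usub_mx mulmx_lsub (mulVmx uWt) [1%:M]scalar_mx_block.
    by rewrite block_mxEh row_mxKl col_mxKu; apply: map_mx1.
  by rewrite -{1}(mxrank1 K k) -e mxrankM_maxr.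
have [T uT hT] := column_reduction rN1.
have e2 : lsubmx (W^T *m block_mx T 0 0 1%:M) = lsubmx W^T *m T.
  rewrite -{1}[W^T]hsubmxK mul_row_block row_mxKl mulmx0 addr0; exact: erefl.
exists (W^T *m block_mx T 0 0 1%:M); rewrite e2; split=> //.
  by rewrite unitmx_mul uWt unitmxE det_ublock det1 mulr1 -unitmxE.
by rewrite prmxM mulmxA GN1 mul0mx.
Qed.

End ColumnReduction.

Lemma split_inverse (L : nzRingType) k r (U V : 'M[L]_(k + r)) : V *m U = 1%:M ->
  [/\ usubmx V *m lsubmx U = 1%:M, usubmx V *m rsubmx U = 0,
      dsubmx V *m lsubmx U = 0 & dsubmx V *m rsubmx U = 1%:M].
Proof.
rewrite -{1}[V]vsubmxK -{1}[U]hsubmxK mul_col_row scalar_mx_block.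
by case/eq_block_mx => -> -> -> ->.
Qed.

(** * Unimodular and biproper completions of a minimal basis *)

Section MinimalBasis.
Variable F : fieldType.
Local Notation K := (ratF F).
Local Notation pr := (@pr F).
Local Notation lam := (@lam F).
Local Notation R := {poly F}.
Local Notation propS := (@propS F).
Local Notation polyS := (@polyS F).

Definition degmx m k (N : 'M[R]_(m, k)) : 'M[K]_k :=
  diag_mx (\row_j lam ^+ cdeg N j).
Definition degmxV m k (N : 'M[R]_(m, k)) : 'M[K]_k :=
  diag_mx (\row_j (lam ^+ cdeg N j)^-1).

Lemma degmxK m k (N : 'M[R]_(m, k)) : degmxV N *m degmx N = 1%:M.
Proof.
rewrite mulmx_diag -diag_const_mx; congr diag_mx; apply/rowP=> j.
by rewrite !mxE mulVf // expf_neq0 // lam_neq0.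
Qed.

Lemma det_degmx m k (N : 'M[R]_(m, k)) : \det (degmx N) = lam ^+ col_total_deg N.
Proof. by rewrite det_diag /col_total_deg expr_sum; apply: eq_bigr => j _; rewrite mxE. Qed.

Lemma det_degmxV m k (N : 'M[R]_(m, k)) : \det (degmxV N) = (lam ^+ col_total_deg N)^-1.
Proof.
apply: (mulIf (x := lam ^+ col_total_deg N)); first by rewrite expf_neq0 // lam_neq0.
by rewrite mulVf ?expf_neq0 ?lam_neq0 // -{1}det_degmx -det_mulmx degmxK det1.
Qed.

Lemma dle_size (a : R) c : (size a <= c)%N -> dle (c%:Z - 1) (pr a).
Proof.
have [->|a0] := eqVneq a 0; first by rewrite rmorph0; left.
move=> h; apply: dle_pr; move: a0 h; rewrite -size_poly_gt0 /pdeg.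
by move: (size a); lia.
Qed.

(** Dividing each column by [lambda] to its degree leaves the leading coefficients as value at
    infinity. *)
Lemma normalized_near m k (N : 'M[R]_(m, k)) :
  mxover (dle (-1)) (prmx N *m degmxV N - map_mx (@cst F) (hc N)).
Proof.
move=> i j; rewrite mul_mx_diag !mxE; set c := cdeg N j.
have l0 : lam ^+ c != 0 by rewrite expf_neq0 // lam_neq0.
have -> : pr (N i j) / lam ^+ c - cst (N i j)`_c =
    pr (N i j - (N i j)`_c *: 'X^c) * (lam ^+ c)^-1.
  rewrite rmorphB /= mulrBl -mul_polyC rmorphM /= rmorphXn /= -/lam.
  by congr (_ - _); rewrite mulfK.
apply: (dle_trans (k := (c%:Z - 1) - c%:Z)); first by lia.
apply: dleM; last by rewrite exprnN; apply: dle_lam.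
apply: dle_size; apply/leq_sizeP=> d hd; rewrite coefB coefZ coefXn.
case: eqP => [->|/eqP dc]; first by rewrite mulr1 subrr.
rewrite mulr0 subr0 nth_default //; apply: leq_trans (size_cdeg N i j) _.
by rewrite ltn_neqAle eq_sym dc.
Qed.

Lemma normalized_proper m k (N : 'M[R]_(m, k)) : mxover propS (prmx N *m degmxV N).
Proof. exact: near_cst_over (normalized_near N). Qed.

(** A column reduced kernel basis [N0] has a unimodular completion [U], and its normalization has a
    biproper completion [B]. The last [r] rows [Y] and [Z] of the two inverses both annihilate the
    kernel, hence differ by a square factor [T]; comparing determinants gives the degree of
    [det T]. *)
Lemma min_right_basis p k r (G : 'M[K]_(p, k + r)) (e : nat) : \rank G = r ->
  (exists N : 'M[R]_(k + r, k),
    [/\ G *m prmx N = 0, \rank (prmx N) = k & col_total_deg N = e]) ->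
  (forall N : 'M[R]_(k + r, k),
    G *m prmx N = 0 -> \rank (prmx N) = k -> (e <= col_total_deg N)%N) ->
  exists (Y Z : 'M[K]_(r, k + r)) (Y' Z' : 'M[K]_(k + r, r)) (T : 'M[K]_r),
    [/\ [/\ mxover polyS Y, mxover polyS Y', mxover propS Z & mxover propS Z'],
        Y *m Y' = 1%:M, Z *m Z' = 1%:M, Y = T *m Z &
        [/\ G = G *m Y' *m Y, T \in unitmx & rdeg (\det T) = e%:Z]].
Proof.
move=> rG [N [GN rN eN]] Nmin.
have pS := prop_subring F; have qS := poly_subring F.
have [U [uU GU rU]] := kernel_basis rG.
set N0 := lsubmx U in GU rU.
pose V := prmx (invmx U).
have VU : V *m prmx U = 1%:M by rewrite -prmxM mulVmx //; apply: map_mx1.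
have UV : prmx U *m V = 1%:M by rewrite -prmxM mulmxV //; apply: map_mx1.
have [V00 V01 V10 V11] := split_inverse VU.
have eN0 : lsubmx (prmx U) = prmx N0 by rewrite -map_lsubmx.
rewrite eN0 in V00 V10.
set U' := rsubmx (prmx U) in V01 V11.
have UVe : prmx N0 *m usubmx V + U' *m dsubmx V = 1%:M.
  by rewrite -UV -eN0 -mul_row_col hsubmxK vsubmxK.
(* Constant columns complete [hc N0] to an invertible value at infinity, which makes [B]
   biproper. *)
have [C uC] := basis_completion rU.
pose B : 'M[K]_(k + r) := row_mx (prmx N0 *m degmxV N0) (map_mx (@cst F) C).
have nB : mxover (dle (-1)) (B - map_mx (@cst F) (row_mx (hc N0) C)).
  rewrite map_row_mx opp_row_mx add_row_mx subrr => i j; rewrite mxE.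
  by case: split => j'; [apply: normalized_near|rewrite mxE; left].
have [uB dB iB] := near_cst_unit uC nB.
have sB := near_cst_over nB.
have [W00 W01 W10 W11] := split_inverse (mulVmx uB).
have BW : lsubmx B *m usubmx (invmx B) + rsubmx B *m dsubmx (invmx B) = 1%:M.
  by rewrite -mul_row_col hsubmxK vsubmxK mulmxV.
have lB : lsubmx B = prmx N0 *m degmxV N0 by rewrite row_mxKl.
set Y := dsubmx V in V10 V11 UVe; set Z := dsubmx (invmx B) in W10 W11 BW.
set B' := rsubmx B in W01 W11 BW.
(* The reduced basis attains the minimum. A minimal [N] is [N0 P] with [P] polynomial, and
   [degmx N0 *m P *m degmxV N] is proper; its determinant has degree at most 0 while [det P] has
   degree at least 0. *)
have sN0 : col_total_deg N0 = e.
  apply/eqP; rewrite eqn_leq; apply/andP; split; last first.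
    apply: Nmin => //; apply/eqP; rewrite eqn_leq rank_leq_col /=.
    by rewrite -{1}(mxrank1 K k) -V00 mxrankM_maxr.
  pose P := usubmx V *m prmx N.
  have GUY : G = (G *m U') *m Y.
    by rewrite -{1}[G]mulmx1 -UVe mulmxDr !mulmxA GU mul0mx add0r.
  have YN : Y *m prmx N = 0.
    have : row_full (G *m U').
      rewrite /row_full eqn_leq rank_leq_col /=.
      by rewrite -{1}rG {1}GUY mxrankM_maxl.
    case/row_fullP=> X hX; rewrite -[LHS]mul1mx -hX -mulmxA (mulmxA _ Y) -GUY GN.
    exact: mulmx0.
  have NP : prmx N = prmx N0 *m P.
    by rewrite -{1}[prmx N]mul1mx -UVe mulmxDl -!mulmxA YN mulmx0 addr0.
  have sP : mxover polyS P.
    by apply: mxoverM => //; [apply: mxover_usub|]; apply: mxover_prmx.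
  have P0 : \det P != 0.
    rewrite -unitfE -unitmxE -row_full_unit /row_full eqn_leq rank_leq_col /=.
    by rewrite -{1}rN NP mxrankM_maxr.
  pose Q := usubmx (invmx B) *m (prmx N *m degmxV N).
  have sQ : mxover propS Q.
    by apply: mxoverM => //; [apply: mxover_usub|apply: normalized_proper].
  have eQ : Q = degmx N0 *m P *m degmxV N.
    rewrite /Q NP -[prmx N0]mulmx1 -(degmxK N0) (mulmxA (prmx N0)) -lB.
    by rewrite !mulmxA W00 mul1mx.
  have dQ : \det Q = lam ^+ col_total_deg N0 * \det P / lam ^+ col_total_deg N.
    by rewrite eQ !det_mulmx det_degmx det_degmxV.
  have l0 c : lam ^+ c != 0 by exact: (expf_neq0 _ (lam_neq0 F)).
  have : dle 0 (\det Q) := mxover_det pS sQ.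
  case=> [/eqP|].
    by rewrite dQ !mulf_eq0 invr_eq0 (negPf P0) !(negPf (l0 _)).
  rewrite dQ rdegM ?mulf_neq0 ?invr_eq0 ?l0 // rdegM ?l0 //.
  rewrite rdegV ?l0 // !exprnP !rdeg_lam.
  have [a ea] : exists a, \det P = pr a by apply/polySP; exact: (mxover_det qS sP).
  rewrite ea rdeg_pr; last by rewrite -pr_eq0 -ea.
  rewrite eN; move: (col_total_deg N0) (pdeg a) => x y; lia.
pose T := Y *m B'.
(* [Y] annihilates [N0], so in [1 = B B^-1] only the summand [B' Z] contributes. *)
have YT : Y = T *m Z.
  by rewrite -mulmxA -[LHS]mulmx1 -BW mulmxDr !mulmxA lB !mulmxA V10 !mul0mx add0r.
(* [V B] is block triangular with diagonal blocks [degmxV N0] and [T]. *)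
have dT : \det V * \det B = (lam ^+ e)^-1 * \det T.
  rewrite -det_mulmx -[V]vsubmxK -[B]hsubmxK mul_col_row -/Y -/B' lB.
  rewrite !(mulmxA _ (prmx N0)) V00 V10 mul1mx mul0mx det_ublock.
  by rewrite det_degmxV sN0.
have dV : rdeg (\det V) = 0.
  apply: (polyS_unit (y := \det (prmx U))).
  - exact: (mxover_det qS (mxover_prmx _)).
  - exact: (mxover_det qS (mxover_prmx _)).
  - by rewrite -det_mulmx VU det1.
have V0 : \det V != 0.
  by have [uV _] := mulmx1_unit VU; exact: det_neq0 uV.
have B0 : \det B != 0 := det_neq0 uB.
have l0 : lam ^+ e != 0 := expf_neq0 _ (lam_neq0 F).
have T0 : \det T != 0.
  apply/eqP=> T0; move: (mulf_neq0 V0 B0).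
  by rewrite dT T0 mulr0 eqxx.
exists Y, Z, U', B', T; split; [split| | | |split].
- by apply: mxover_dsub; apply: mxover_prmx.
- by apply: mxover_rsub; apply: mxover_prmx.
- exact: mxover_dsub.
- exact: mxover_rsub.
- exact: V11.
- exact: W11.
- exact: YT.
- by rewrite -{1}[G]mulmx1 -UVe mulmxDr !mulmxA GU mul0mx add0r.
- exact: det_unit T0.
- move/(congr1 (@rdeg F)): dT; rewrite (rdegM V0 B0) (rdegM (invr_neq0 l0) T0) dV dB.
  rewrite (rdegV l0) exprnP rdeg_lam; move: (rdeg (\det T)) => x; lia.
Qed.
End MinimalBasis.

(** * The index sum theorem *)

Section MinimalIndices.
Variable F : fieldType.
Local Notation K := (ratF F).
Local Notation pr := (@pr F).
Local Notation lam := (@lam F).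
Local Notation R := {poly F}.
Local Notation propS := (@propS F).
Local Notation polyS := (@polyS F).
Local Notation delta := (delta (@rdeg F)).

Lemma min_right_basis_cast p m k r (G : 'M[K]_(p, m)) (e : nat) :
  m = (k + r)%N -> \rank G = r ->
  (exists N : 'M[R]_(m, k),
    [/\ G *m prmx N = 0, \rank (prmx N) = k & col_total_deg N = e]) ->
  (forall N : 'M[R]_(m, k),
    G *m prmx N = 0 -> \rank (prmx N) = k -> (e <= col_total_deg N)%N) ->
  exists (Y Z : 'M[K]_(r, m)) (Y' Z' : 'M[K]_(m, r)) (T : 'M[K]_r),
    [/\ [/\ mxover polyS Y, mxover polyS Y', mxover propS Z & mxover propS Z'],
        Y *m Y' = 1%:M, Z *m Z' = 1%:M, Y = T *m Z &
        [/\ G = G *m Y' *m Y, T \in unitmx & rdeg (\det T) = e%:Z]].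
Proof. by move=> em; subst m; apply: min_right_basis. Qed.

(** The polynomial factors [Yl], [Yr] give a core [H] over the polynomial ring. Substituting
    [Y = T Z] on both sides gives the core [Tl^T H Tr] over the proper ring, and the degrees of
    [det Tl] and [det Tr] are the left and right index sums. *)
Lemma mu_delta p m (G : 'M[K]_(p, m)) k : mu G k ->
  exists z, delta polyS G (\rank G) z /\ delta propS G (\rank G) (z + k%:Z).
Proof.
move=> [kr [kl [[[Nr [[Nr1 Nr2] Nr3]] minr] [[Nl [[Nl1 Nl2] Nl3]] minl] ->]]].
have [||Nn h1 h2|Yr [Zr [Yr' [Zr' [Tr [[sYr sYr' sZr sZr'] hYr hZr eYr [eGr uTr dTr]]]]]]] :=
  @min_right_basis_cast p m (m - \rank G) (\rank G) G kr _ (erefl _).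
- by rewrite subnK ?rank_leq_col.
- by exists Nr.
- exact: minr.
have trc a b (N : 'M[R]_(a, b)) : col_total_deg N^T = row_total_deg N.
  by apply: eq_bigr => i _; apply: eq_bigr => j _; rewrite mxE.
have [|||Nn h1 h2|Yl [Zl [Yl' [Zl' [Tl [[sYl sYl' sZl sZl'] hYl hZl eYl [eGl uTl dTl]]]]]]] :=
  @min_right_basis_cast m p (p - \rank G) (\rank G) G^T kl.
- by rewrite subnK ?rank_leq_row.
- exact: mxrank_tr.
- exists Nl^T; split; last by rewrite trc.
    by rewrite prmx_tr -trmx_mul Nl1 trmx0.
  by rewrite prmx_tr mxrank_tr.
- rewrite -[Nn]trmxK trc; apply: minl; split.
    by apply: trmx_inj; rewrite trmx_mul prmx_tr trmxK trmx0.
  by rewrite prmx_tr mxrank_tr.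
pose H := Yl'^T *m G *m Yr'.
have eG : G = Yl^T *m H *m Yr.
  have e1 : G = Yl^T *m (Yl'^T *m G).
    by apply: trmx_inj; rewrite !trmx_mul !trmxK.
  by rewrite /H !mulmxA -(mulmxA _ _ G) -e1 -eGr.
have uH : H \in unitmx.
  rewrite -row_full_unit /row_full eqn_leq rank_leq_col /= {1}eG.
  exact: leq_trans (mxrankM_maxl _ _) (mxrankM_maxr _ _).
exists (rdeg (\det H)); split.
  exists Yl^T, Yl'^T, H, Yr, Yr'; split.
  - by split=> //; apply: mxover_tr.
  - by rewrite -trmx_mul hYl trmx1.
  - exact: hYr.
  - exact: eG.
  - by [].
exists Zl^T, Zl'^T, (Tl^T *m H *m Tr), Zr, Zr'; split.
- by split=> //; apply: mxover_tr.
- by rewrite -trmx_mul hZl trmx1.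
- exact: hZr.
- by apply: (etrans eG); rewrite eYl eYr trmx_mul !mulmxA.
- split; first by rewrite !unitmx_mul unitmx_tr uTl uH uTr.
  rewrite !det_mulmx det_tr.
  have [a b] := (det_neq0 uTl, det_neq0 uH).
  rewrite (rdegM (mulf_neq0 a b) (det_neq0 uTr)) (rdegM a b) dTl dTr.
  by move: (rdeg _) => x; lia.
Qed.

End MinimalIndices.

(** * Orders at infinity and coprime realizations *)

Section Orders.
Variable F : fieldType.
Local Notation K := (ratF F).
Local Notation pr := (@pr F).
Local Notation lam := (@lam F).
Local Notation R := {poly F}.
Local Notation propS := (@propS F).
Local Notation polyS := (@polyS F).

Lemma biproperP n (B : 'M[K]_n) : biproper B ->
  [/\ mxover propS B, B \in unitmx & mxover propS (invmx B)].
Proof. 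
by move=> [h1 h2 h3]; split=> // i j; apply/proper_dle; [exact: h1|exact: h3].
Qed.

(** Biproper factors preserve degree bounds on the entries, so [- q_1] is the largest entry degree
    of a nonzero [G]. The bound [d] must be attained, except for [d = 0], where the minimum with 0
    cuts off. *)
Lemma inf_g_eq p m (G : 'M[K]_(p, m)) g (d : nat) :
  inf_g G g -> mxover (dle d%:Z) G ->
  d = 0%N \/ (exists i j, ~ dle (d%:Z - 1) (G i j)) -> g = - d%:Z.
Proof.
move=> [q [[sq srt [B1 [B2 [bB1 bB2 eS]]]] ->]] dG hd.
have [sB1 uB1 sB1'] := biproperP bB1; have [sB2 uB2 sB2'] := biproperP bB2.
(* In rank 0 the list [q] is empty and the default of [head] gives [g = 0]; the second alternative
   is excluded since [G = 0]. *)
have [r0|r0] := posnP (\rank G).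
  case: hd => [->|[i [j []]]]; first by rewrite (size0nil (etrans sq r0)).
  move/eqP: r0; rewrite mxrank_eq0 => /eqP->; rewrite mxE; exact: dle0.
set Sg := \matrix_(i, j) _ in eS.
have eq0 : head 0 q = q`_0 by case: (q).
rewrite eq0.
have lo : - q`_0 <= d%:Z.
  have p0 : (0 < p)%N := leq_trans r0 (rank_leq_row _).
  have m0 : (0 < m)%N := leq_trans r0 (rank_leq_col _).
  have := dle_mulmxr (dle_mulmxl sB1 dG) sB2.
  rewrite eS => /(_ (Ordinal p0) (Ordinal m0)); rewrite mxE eqxx r0 /=.
  case=> [/eqP|]; first by rewrite (negPf (lamz_neq0 _ _)).
  by rewrite rdeg_lam.
have hi : mxover (dle (- q`_0)) G.
  have -> : G = invmx B1 *m Sg *m invmx B2.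
    by rewrite -eS -!mulmxA (mulmxV uB2) mulmx1 (mulKmx uB1).
  apply: dle_mulmxr => //; apply: dle_mulmxl => // i j; rewrite mxE.
  case: ifP => [/andP[_ hi]|_]; last exact: dle0.
  apply: dle_trans (dle_lam _ _); rewrite lerN2.
  by apply: (sorted_leq_nth le_trans lexx 0 srt) => //; rewrite inE sq.
case: hd => [d0|[i [j hij]]].
  by move: lo; rewrite d0 oppr_le0 => lo; rewrite min_l.
have h2 : ~ (- q`_0 <= d%:Z - 1).
  by move=> h; apply: hij; apply: dle_trans h (hi i j).
by move: h2 lo; move: (q`_0) => x; lia.
Qed.

(** The strictly proper part has degree at most [-1] and cannot cancel a term of degree [d]. The
    value [d = 0] is kept apart because it also covers [D = 0]. *)
Lemma poly_part_dle p m (G : 'M[K]_(p, m)) (D : 'M[R]_(p, m)) :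
  poly_part G D -> let d := pmx_deg D in
  mxover (dle d%:Z) G /\ (d = 0%N \/ (exists i j, ~ dle (d%:Z - 1) (G i j))).
Proof.
move=> hD d.
have sp i j : dle (-1) (G i j - pr (D i j)).
  by have := hD i j; rewrite !mxE => /strictly_proper_dle.
have dD i j : (pdeg (D i j) <= d)%N.
  apply: leq_trans (leq_bigmax (F := fun i => \max_(j < m) pdeg (D i j))%N i).
  exact: (leq_bigmax (F := fun j => pdeg (D i j))).
split.
  move=> i j; rewrite -[G i j](subrK (pr (D i j))); apply: dleD.
    by apply: dle_trans (sp i j); lia.
  by apply: dle_pr; rewrite lez_nat.
have [d0|d0] := posnP d; [by left|right].
have /existsP[i /existsP[j /eqP hij]] : [exists i, exists j, pdeg (D i j) == d].
  apply: contraLR d0 => h; rewrite -leqNgt.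
  have h' i j : (pdeg (D i j) <= d.-1)%N.
    move: h; rewrite negb_exists => /forallP/(_ i); rewrite negb_exists.
    by move=> /forallP/(_ j); have := dD i j; move: (pdeg _) => x; lia.
  suff : (d <= d.-1)%N by lia.
  by apply/bigmax_leqP => i _; apply/bigmax_leqP => j _.
exists i, j => h.
have : dle (d%:Z - 1) (pr (D i j)).
  rewrite -[pr _](subKr (G i j)); apply: dleD => //; apply: dleN.
  by apply: dle_trans (sp i j); lia.
have Dn : D i j != 0.
  by apply/eqP=> e; move: d0; rewrite -hij e /pdeg size_poly0.
case=> [/eqP|]; first by rewrite pr_eq0 (negPf Dn).
by rewrite rdeg_pr // hij; lia.
Qed.

Lemma realizes_mul p m p' m' (G : 'M[K]_(p, m)) k (A : 'M[R]_k) B C D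
    (Q : 'M[R]_(p', p)) (P : 'M[R]_(m, m')) : realizes G A B C D ->
  realizes (prmx Q *m G *m prmx P) A (B *m P) (Q *m C) (Q *m D *m P).
Proof.
move=> [dA ->]; split=> //.
by rewrite !prmxM mulmxDr mulmxDl !mulmxA.
Qed.

Lemma realizes_tr p m (G : 'M[K]_(p, m)) k (A : 'M[R]_k) B C D :
  realizes G A B C D -> realizes G^T A^T C^T B^T D^T.
Proof.
move=> [dA ->]; split; first by rewrite det_tr.
by rewrite !prmx_tr linearD /= !trmx_mul trmx_inv mulmxA.
Qed.

(* [W [C; A] = [0; H]] with [W] unimodular cancels the common right divisor [H]
   of [C] and [A], leaving a realization whose order is smaller by [deg det H]. *)
Lemma min_order_coprime p m ph mh n (G : 'M[K]_(p, m)) (Gh : 'M[K]_(ph, mh))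
    (Q : 'M[R]_(p, ph)) (P : 'M[R]_(mh, m)) (A : 'M[R]_n) B C D :
  (forall k A B C D, @realizes F p m G k A B C D -> (pdeg (\det A) >= n)%N) ->
  G = prmx Q *m Gh *m prmx P -> realizes Gh A B C D -> pdeg (\det A) = n ->
  forall k (x : 'M[K]_(n, k)), mxover polyS (prmx A *m x) ->
  mxover polyS (prmx C *m x) -> mxover polyS x.
Proof.
move=> hmin eG [dA eGh] hn k x hA hC.
have [|W uW hW] := zero_rows (P := col_mx C A); first exact: rank_leq_col.
have [H eH] : exists H, H = dsubmx (W *m col_mx C A) by exists (dsubmx (W *m col_mx C A)).
have [V eV] : exists V, V = invmx W by exists (invmx W).
have eCA : col_mx C A = col_mx (ursubmx V *m H) (drsubmx V *m H).
  rewrite -[LHS](mulKmx uW) -[W *m _]vsubmxK hW -eH -eV -{1}[V]submxK mul_block_col.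
  by rewrite !mulmx0 !add0r.
have [eC eA] := eq_col_mx eCA.
have eAd : \det A = \det (drsubmx V) * \det H by rewrite {1}eA det_mulmx.
have [d1 d2] : \det (drsubmx V) != 0 /\ \det H != 0.
  by apply/andP; rewrite -negb_or -mulf_eq0 -eAd.
have up (M : 'M[R]_n) : \det M != 0 -> prmx M \in unitmx.
  by move=> M0; apply: det_unit; rewrite det_map_mx pr_eq0.
have eCA' : prmx C *m invmx (prmx A) = prmx (ursubmx V) *m invmx (prmx (drsubmx V)).
  have pA : prmx A = prmx (drsubmx V) *m prmx H by rewrite -prmxM -eA.
  have pC : prmx C = prmx (ursubmx V) *m prmx H by rewrite -prmxM -eC.
  have h : prmx C = prmx (ursubmx V) *m invmx (prmx (drsubmx V)) *m prmx A.
    by rewrite pA mulmxA (mulmxKV (up _ d1)).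
  by rewrite {1}h (mulmxK (up _ dA)).
have re : realizes Gh (drsubmx V) B (ursubmx V) D.
  split; first exact: d1.
  exact: (etrans eGh (congr1 (fun X => prmx D + X *m prmx B) eCA')).
(* [Q] and [P] turn the reduced realization of [Gh] into one of [G], so minimality of [n] forces
   [det H] to be constant. *)
subst G; have h := hmin _ _ _ _ _ (realizes_mul Q P re).
have dH : pdeg (\det H) = 0%N.
  move: hn h; rewrite eAd /pdeg (size_mul d1 d2).
  move: d1 d2; rewrite -!size_poly_gt0.
  by move: (size _) (size _) => a b; lia.
have uH : H \in unitmx.
  have sH : size (\det H) == 1%N.
    by move: dH d2; rewrite /pdeg -size_poly_gt0; move: (size _) => a; lia.
  rewrite unitmxE poly_unitE sH /= unitfE.
  by move: d2; rewrite -lead_coef_eq0 lead_coefE (eqP sH).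
(* [x = H^-1 (H x)], where [H x] is the lower part of [W [C; A] x], polynomial by hypothesis. *)
have -> : x = prmx (invmx H) *m (dsubmx (prmx W *m (prmx (col_mx C A) *m x))).
  rewrite mulmxA -prmxM -mul_dsub_mx -map_dsubmx -/(prmx _) -eH.
  by rewrite mulmxA -prmxM (mulVmx uH) /prmx map_mx1 mul1mx.
have pS := poly_subring F.
apply: (mxoverM pS); first exact: mxover_prmx.
apply: mxover_dsub; apply: (mxoverM pS); first exact: mxover_prmx.
rewrite /prmx map_col_mx mul_col_mx; apply: mxover_col; [exact: hC|exact: hA].
Qed.
End Orders.

(** * Pencils and strong linearizations *)

Section Pencils.
Variable F : fieldType.
Local Notation K := (ratF F).
Local Notation pr := (@pr F).
Local Notation lam := (@lam F).
Local Notation R := {poly F}.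
Local Notation propS := (@propS F).
Local Notation polyS := (@polyS F).
Local Notation delta := (delta (@rdeg F)).

(** Division by [lambda] makes the pencil proper, with value [M1] at infinity. *)
Definition npencil m n (M1 M0 : 'M[F]_(m, n)) : 'M[K]_(m, n) :=
  lam^-1 *: prmx (pencil M1 M0).

Lemma pencilE m n (M1 M0 : 'M[F]_(m, n)) :
  prmx (pencil M1 M0) = lam *: npencil M1 M0.
Proof. by rewrite scalerA (divff (lam_neq0 F)) scale1r. Qed.

Lemma npencil_near m n (M1 M0 : 'M[F]_(m, n)) :
  mxover (dle (-1)) (npencil M1 M0 - map_mx (@cst F) M1).
Proof.
move=> i j; rewrite !mxE rmorphD rmorphM /= -/lam mulrDr.
rewrite (mulrC (pr _) lam) mulKf ?lam_neq0 // addrAC subrr add0r -exprN1.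
exact: dleM0r (dle_lam _ _) (propS_cst _).
Qed.

Lemma det_pencil n (M1 M0 : 'M[F]_n) :
  pr (\det (pencil M1 M0)) = lam ^+ n * \det (npencil M1 M0).
Proof. by rewrite -det_map_mx -/(prmx _) pencilE detZ. Qed.

Lemma det_pencil_le n (M1 M0 : 'M[F]_n) : (pdeg (\det (pencil M1 M0)) <= n)%N.
Proof.
have [->|d0] := eqVneq (\det (pencil M1 M0)) 0; first by rewrite /pdeg size_poly0.
have l0 : lam ^+ n != 0 := expf_neq0 _ (lam_neq0 F).
have hM : mxover propS (npencil M1 M0) := near_cst_over (npencil_near M1 M0).
have h : propS (\det (npencil M1 M0)) := mxover_det (prop_subring F) hM.
have n0 : \det (npencil M1 M0) != 0.
  by apply: contraNneq d0 => e; rewrite -pr_eq0 det_pencil e mulr0.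
have := rdeg_pr d0; rewrite det_pencil (rdegM l0 n0) exprnP rdeg_lam.
case: h => [/eqP|]; first by rewrite (negPf n0).
by move: (rdeg _) (pdeg _) => a b; lia.
Qed.

(** [det M1] is the coefficient of degree [n] in the determinant of the pencil. *)
Lemma det_pencil_eq n (M1 M0 : 'M[F]_n) : \det (pencil M1 M0) != 0 ->
  pdeg (\det (pencil M1 M0)) = n -> M1 \in unitmx.
Proof.
move=> d0 dn; apply: det_unit; apply/eqP=> e.
have := near_cst_det (npencil_near M1 M0).
rewrite e rmorph0 subr0 => h.
have : dle (n%:Z - 1) (pr (\det (pencil M1 M0))).
  by rewrite det_pencil; apply: dleM => //; rewrite exprnP; apply: dle_lam.
case=> [/eqP|]; first by rewrite pr_eq0 (negPf d0).
by rewrite rdeg_pr // dn; lia.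
Qed.

(** A rank factorization over [F] has one-sided inverses over [F], so the identity serves as
    core. *)
Lemma delta_const m n (N : 'M[F]_(m, n)) (S : K -> Prop) :
  (forall c, S (cst c)) ->
  delta S (map_mx (@cst F) N) (\rank N) 0.
Proof.
move=> sc.
have [X' hX] := row_fullP (col_base_full N).
have [Y' hY] := row_freeP (row_base_free N).
have so a b (M : 'M[F]_(a, b)) : mxover S (map_mx (@cst F) M) by move=> i j; rewrite mxE.
exists (map_mx (@cst F) (col_base N)), (map_mx (@cst F) X'), 1%:M,
  (map_mx (@cst F) (row_base N)), (map_mx (@cst F) Y'); split.
- by split.
- by rewrite -map_mxM hX map_mx1.
- by rewrite -map_mxM hY map_mx1.
- by rewrite mulmx1 -map_mxM mulmx_base.
- by rewrite unitmx1 det1 rdeg1.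
Qed.

Section Transfer.
Variables (n p m s : nat).
Variables (A1 A0 : 'M[F]_n) (B1 B0 : 'M[F]_(n, m + s)).
Variables (C1 C0 : 'M[F]_(p + s, n)) (D1 D0 : 'M[F]_(p + s, m + s)).
Hypothesis uA1 : A1 \in unitmx.
Let Gh := lin_transfer A1 A0 B1 B0 C1 C0 D1 D0.
Let M := D1 + C1 *m invmx A1 *m B1.
Let nA := npencil A1 A0.

Lemma npencil_unit : [/\ nA \in unitmx, rdeg (\det nA) = 0 & mxover propS (invmx nA)].
Proof. exact: near_cst_unit uA1 (npencil_near A1 A0). Qed.

Lemma invmx_pencil : invmx (prmx (pencil A1 A0)) = lam^-1 *: invmx nA.
Proof.
have [u _ _] := npencil_unit.
have ul : lam *: nA \in unitmx.
  apply: det_unit; rewrite detZ; apply: mulf_neq0 (det_neq0 u).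
  exact: expf_neq0 (lam_neq0 F).
by rewrite pencilE; exact: invmxZ ul.
Qed.

Lemma pencil_left_proper : mxover propS (invmx (prmx (pencil A1 A0)) *m prmx (pencil B1 B0)).
Proof.
have [_ _ h] := npencil_unit.
rewrite invmx_pencil pencilE -scalemxAl -scalemxAr scalerA (mulVf (lam_neq0 F)) scale1r.
exact: (mxoverM (prop_subring F) h (near_cst_over (npencil_near B1 B0))).
Qed.

Lemma pencil_right_proper : mxover propS (prmx (pencil C1 C0) *m invmx (prmx (pencil A1 A0))).
Proof.
have [_ _ h] := npencil_unit.
rewrite invmx_pencil pencilE -scalemxAl -scalemxAr scalerA (divff (lam_neq0 F)) scale1r.
exact: (mxoverM (prop_subring F) (near_cst_over (npencil_near C1 C0)) h).
Qed.

(** In [C A^-1 B] one of the two factors [lambda] cancels against [A^-1], so [Gh / lambda] is proper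
    with value [M] at infinity. *)
Lemma transfer_near : exists2 N : 'M[K]_(p + s, m + s), Gh = lam *: N &
  mxover (dle (-1)) (N - map_mx (@cst F) M).
Proof.
exists (npencil D1 D0 + npencil C1 C0 *m invmx nA *m npencil B1 B0).
  rewrite /Gh /lin_transfer invmx_pencil !pencilE scalerDr; congr (_ + _).
  rewrite -!scalemxAr -!scalemxAl.
  by rewrite (scalerA lam^-1 lam) (mulVf (lam_neq0 F)) scale1r.
rewrite /M raddfD /= opprD addrACA => i j; rewrite mxE; apply: dleD.
  exact: npencil_near.
apply: near_cstM; last exact: npencil_near.
apply: near_cstM; first exact: npencil_near.
exact: near_cst_inv uA1 (npencil_near _ _).
Qed.

(** For [M] nonzero the largest entry degree of [Gh] is 1; for [M = 0] the quotient [Gh / lambda] is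
    strictly proper, so [Gh] is proper. *)
Lemma transfer_inf_g gh : inf_g Gh gh -> gh = - (M != 0)%:Z.
Proof.
move=> hg; have [N eN nN] := transfer_near.
have dG k : mxover (dle k) N -> mxover (dle (1 + k)) Gh.
  by move=> h i j; rewrite eN mxE; apply: dleM (dle_lam F 1) (h i j).
have [M0|M0] := eqVneq M 0.
  apply: (inf_g_eq (d := 0) hg); last by left.
  have -> : 0%:Z = 1 + (- 1) by [].
  by apply: dG; move: nN; rewrite M0 map_mx0 subr0.
apply: (inf_g_eq (d := 1) hg).
  by rewrite -[1%:Z]addr0; apply: dG; apply: near_cst_over nN.
right; have [i [j Mij]] : exists i j, M i j != 0.
  have : ~~ [forall i, forall j, M i j == 0].
    apply: contra M0 => /forallP h; apply/eqP/matrixP=> i j; rewrite [RHS]mxE.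
    by move: (h i) => /forallP/(_ j)/eqP.
  by rewrite negb_forall => /existsP[i]; rewrite negb_forall => /existsP[j h]; exists i, j.
exists i, j => h.
have hN : dle (-1) (N i j).
  have -> : N i j = lam ^ (-1) * Gh i j.
    by rewrite eN mxE mulrA exprN1 (mulVf (lam_neq0 F)) mul1r.
  by apply: (dle_trans (k := -1 + (1%:Z - 1))) => //; apply: dleM => //; apply: dle_lam.
have : dle (-1) (cst (M i j)).
  rewrite -[cst _](subKr (N i j)); apply: dleD => //; apply: dleN.
  by have := nN i j; rewrite !mxE.
case=> [/eqP|]; first by rewrite fmorph_eq0 (negPf Mij).
by rewrite rdeg_cst.
Qed.

End Transfer.
End Pencils.

(** * Comparison of the indices of [G] and of its strong linearization *)

Section StrongLinearization.
Variable F : fieldType.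
Local Notation K := (ratF F).
Local Notation pr := (@pr F).
Local Notation lam := (@lam F).
Local Notation R := {poly F}.
Local Notation propS := (@propS F).
Local Notation polyS := (@polyS F).
Local Notation delta := (delta (@rdeg F)).

Lemma prmxN m n (A : 'M[R]_(m, n)) : prmx (- A) = - prmx A.
Proof. exact: map_mxN. Qed.

(** If [Gh V = 0] with [V] polynomial, then [x = A^-1 B V] satisfies [A x = B V] and [C x = - D V],
    so coprimeness makes [x] polynomial. The transposed argument handles left annihilators, which
    supplies both hypotheses of [delta_system]. *)
Lemma delta_min_system p m ph mh n (G : 'M[K]_(p, m)) (Gh : 'M[K]_(ph, mh))
    (Q : 'M[R]_(p, ph)) (P : 'M[R]_(mh, m)) (A : 'M[R]_n) B C D r z :
  (forall k A B C D, @realizes F p m G k A B C D -> (pdeg (\det A) >= n)%N) ->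
  G = prmx Q *m Gh *m prmx P -> realizes Gh A B C D -> pdeg (\det A) = n ->
  delta polyS Gh r z ->
  delta polyS (prmx (block_mx A B (- C) D)) (n + r) (n%:Z + z).
Proof.
move=> hmin eG re dA hz; have [A0 eGh] := re.
have pS := poly_subring F.
have uA : prmx A \in unitmx by apply: det_unit; rewrite det_map_mx pr_eq0.
have hminT k A' B' C' D' : @realizes F m p G^T k A' B' C' D' -> (pdeg (\det A') >= n)%N.
  by move=> /realizes_tr h; rewrite -det_tr; apply: hmin; rewrite -[G]trmxK; exact: h.
have eGT : G^T = prmx P^T *m Gh^T *m prmx Q^T.
  by rewrite eG !trmx_mul -!prmx_tr mulmxA.
have hn : rdeg (\det (prmx A)) = n%:Z by rewrite det_map_mx rdeg_pr // dA.
have -> : prmx (block_mx A B (- C) D) =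
    block_mx (prmx A) (prmx B) (- prmx C) (prmx D).
  by rewrite -prmxN; exact: map_block_mx.
rewrite -hn.
apply: (delta_system (@rdegM F) pS uA).
- move=> k V sV; rewrite -eGh => GV.
  apply: (min_order_coprime hmin eG re dA).
    by rewrite !mulmxA (mulmxV uA) mul1mx; apply: (@mxoverM _ _ pS) _ _ _ _ _ (mxover_prmx B) sV.
  have -> : prmx C *m (invmx (prmx A) *m prmx B *m V) = - (prmx D *m V).
    by apply/eqP; rewrite -addr_eq0 addrC !mulmxA -mulmxDl -eGh GV.
  by apply: (mxoverN pS); apply: (@mxoverM _ _ pS) _ _ _ _ _ (mxover_prmx D) sV.
- move=> k U sU; rewrite -eGh => UG.
  have dAT : pdeg (\det A^T) = n by rewrite det_tr.
  rewrite -[_ *m invmx _]trmxK; apply: mxover_tr.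
  apply: (min_order_coprime hminT eGT (realizes_tr re) dAT).
    rewrite prmx_tr -trmx_mul (mulmxKV uA).
    by apply: mxover_tr; apply: (@mxoverM _ _ pS) _ _ _ _ _ sU (mxover_prmx C).
  rewrite prmx_tr -trmx_mul; apply: mxover_tr.
  have -> : U *m prmx C *m invmx (prmx A) *m prmx B = - (U *m prmx D).
    by apply/eqP; rewrite -addr_eq0 addrC -!mulmxA -mulmxDr mulmxA -eGh UG.
  by apply: (mxoverN pS); apply: (@mxoverM _ _ pS) _ _ _ _ _ sU (mxover_prmx D).
- by rewrite -eGh.
Qed.

Lemma diagI_corner p m s (G : 'M[K]_(p, m)) :
  prmx (row_mx 1%:M 0) *m diagI s G *m prmx (col_mx 1%:M 0) = G.
Proof.
rewrite /prmx map_row_mx map_col_mx !map_mx1 !map_mx0 mul_row_block mul_row_col.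
by rewrite !(mulmx0, mul0mx, mulmx1, mul1mx, addr0, add0r).
Qed.

(** The boolean factor merges the cases [M = 0] and [M != 0]; the term [r + s] stands on the left to
    avoid truncated subtraction. *)
Lemma mu_strong_linearization p m (G : 'M[K]_(p, m)) (D : 'M[R]_(p, m)) n s
    (A1 A0 : 'M[F]_n) (B1 B0 : 'M[F]_(n, m + s)) (C1 C0 : 'M[F]_(p + s, n))
    (D1 D0 : 'M[F]_(p + s, m + s)) muG muL :
  poly_part G D ->
  strong_linearization G A1 A0 B1 B0 C1 C0 D1 D0 ->
  mu G muG ->
  mu (prmx (lin_pencil A1 A0 B1 B0 C1 C0 D1 D0)) muL ->
  let M := D1 + C1 *m invmx A1 *m B1 in
  (muG + (M != 0%R) * (\rank G + s) = muL + pmx_deg D * \rank G)%N.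
Proof.
move=> hD [lo hdet [U1 [U2 [uU1 uU2]]]] + [g [gh [+ + [Bl [Br [bBl bBr]]]]]].
set Gh := lin_transfer _ _ _ _ _ _ _ _ => eGh hg hgh eB hG hL M.
have [_ hmin] := lo.
have pS := poly_subring F; have qS := prop_subring F.
have dA0 : \det (pencil A1 A0) != 0.
  have [n0|/hdet //] := posnP n.
  move: (pencil A1 A0); rewrite n0 => X; by rewrite det_mx00 oner_eq0.
have re : realizes Gh (pencil A1 A0) (pencil B1 B0) (pencil C1 C0) (pencil D1 D0) by split.
pose Q := row_mx (1%:M : 'M[R]_p) (0 : 'M_(p, s)) *m invmx U1.
pose P := invmx U2 *m col_mx (1%:M : 'M[R]_m) (0 : 'M_(s, m)).
have eG : G = prmx Q *m Gh *m prmx P.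
  rewrite -eGh /Q /P !prmxM !prmx_inv // !mulmxA.
  rewrite (mulmxKV (prmx_unit uU1)) (mulmxK (prmx_unit uU2)).
  by rewrite diagI_corner.
(* The size of the pencil bounds the degree above by [n]; minimality of the order of [G] bounds it
   below. Equality then makes [A1] invertible. *)
have hn : pdeg (\det (pencil A1 A0)) = n.
  apply/eqP; rewrite eqn_leq det_pencil_le /=.
  by apply: hmin; rewrite eG; exact: realizes_mul re.
have uA1 := det_pencil_eq dA0 hn.
have [dG hd] := poly_part_dle hD.
have eg := inf_g_eq hg dG hd.
have egh := transfer_inf_g uA1 hgh.
have [z [fz iz]] := mu_delta hG.
have [zL [fL iL]] := mu_delta hL.
set r := \rank G in fz iz *.
have fGh : delta polyS Gh (r + s) z.
  rewrite -eGh; apply: (delta_mul pS (U' := prmx (invmx U1)) (V' := prmx (invmx U2))).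
  - exact: mxover_prmx.
  - exact: mxover_prmx.
  - exact: mxover_prmx.
  - exact: mxover_prmx.
  - by rewrite (prmx_inv uU1) (mulVmx (prmx_unit uU1)).
  - by rewrite (prmx_inv uU2) (mulmxV (prmx_unit uU2)).
  - by rewrite /diagI; apply: (delta_block1 pS); exact: fz.
have [sBl uBl sBl'] := biproperP bBl; have [sBr uBr sBr'] := biproperP bBr.
(* Scaling by [lambda ^ g] acts in rank [r], before the identity block is added; undoing
   [lambda ^ gh] acts in rank [r + s]. *)
have iGh : delta propS Gh (r + s) (z + muG%:Z + g * r%:Z + (- gh) * (r + s)%:Z).
  have -> : Gh = lam ^ (- gh) *: (lam ^ gh *: Gh).
    by rewrite scalerA -expfzDr ?lam_neq0 // addNr expr0z scale1r.
  rewrite -{2}(rdeg_lam F (- gh)).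
  apply: (delta_scale (@rdegM F) (lamz_neq0 _ _)).
  rewrite -eB; apply: (delta_mul qS sBl sBl' sBr sBr' (mulVmx uBl) (mulmxV uBr)).
  rewrite /diagI; apply: (delta_block1 qS).
  by have := delta_scale (@rdegM F) (lamz_neq0 F g) iz; rewrite rdeg_lam.
have fL' := delta_min_system hmin eG re hn fGh.
have uA : prmx (pencil A1 A0) \in unitmx by apply: det_unit; rewrite det_map_mx pr_eq0.
(* Since [A1] is invertible, [A^-1 B] and [C A^-1] are proper, which gives the hypotheses of
   [delta_system] over the proper ring. *)
have iL' : delta propS (prmx (lin_pencil A1 A0 B1 B0 C1 C0 D1 D0)) (n + (r + s))
    (n%:Z + (z + muG%:Z + g * r%:Z + (- gh) * (r + s)%:Z)).
  have -> : prmx (lin_pencil A1 A0 B1 B0 C1 C0 D1 D0) =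
      block_mx (prmx (pencil A1 A0)) (prmx (pencil B1 B0))
        (- prmx (pencil C1 C0)) (prmx (pencil D1 D0)).
    by rewrite -prmxN; exact: map_block_mx.
  have <- : rdeg (\det (prmx (pencil A1 A0))) = n%:Z by rewrite det_map_mx rdeg_pr // hn.
  apply: (delta_system (@rdegM F) qS uA).
  - move=> k V sV _; apply: (@mxoverM _ _ qS) _ _ _ _ _ _ sV.
    exact: pencil_left_proper.
  - move=> k U sU _; rewrite -mulmxA; apply: (@mxoverM _ _ qS) _ _ _ _ _ sU _.
    exact: pencil_right_proper.
  - exact: iGh.
have rL := delta_rank fL'.
rewrite rL in fL iL.
have e1 := delta_uniq (@rdegM F) pS (@polyS_unit F) fL fL'.
have e2 := delta_uniq (@rdegM F) qS (@propS_unit F) iL iL'.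
(* Subtracting the two indices of the pencil leaves [muL = muG + g r - gh (r + s)]. *)
move: e2; rewrite e1 eg egh -/M; move: (pmx_deg D) => d.
by case: (M != 0); nia.
Qed.

(** Both indices of a constant matrix are 0, and [mu] is their difference. *)
Lemma mu_const m n (N : 'M[F]_(m, n)) k : mu (map_mx (@cst F) N) k -> k = 0%N.
Proof.
move=> /mu_delta[z]; rewrite mxrank_map => -[h1 h2].
have z0 := delta_uniq (@rdegM F) (poly_subring F) (@polyS_unit F) h1
  (delta_const N (fun c => polyS_pr _)).
have := delta_uniq (@rdegM F) (prop_subring F) (@propS_unit F) h2
  (delta_const N (@propS_cst F)).
by rewrite z0; lia.
Qed.

Lemma lin_pencil_const p m s (A1 A0 : 'M[F]_0) (B1 B0 : 'M[F]_(0, m + s))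
    (C1 C0 : 'M[F]_(p + s, 0)) (D0 : 'M[F]_(p + s, m + s)) :
  prmx (lin_pencil A1 A0 B1 B0 C1 C0 0 D0) =
  map_mx (@cst F) (block_mx A0 B0 (- C0) D0).
Proof.
have pc a b (X : 'M[F]_(a, b)) : pencil 0 X = map_mx polyC X.
  by apply/matrixP=> i j; rewrite !mxE polyC0 mul0r add0r.
rewrite /lin_pencil (flatmx0 A1) (flatmx0 B1) (thinmx0 C1) !pc -map_mxN.
by rewrite -map_block_mx /prmx -map_mx_comp.
Qed.

End StrongLinearization.

Theorem theorem5p9 (F : fieldType) (p m : nat) (G : 'M[ratF F]_(p, m))
  (D : 'M[{poly F}]_(p, m)) (n s : nat)
  (A1 A0 : 'M[F]_n) (B1 B0 : 'M[F]_(n, m + s))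
  (C1 C0 : 'M[F]_(p + s, n)) (D1 D0 : 'M[F]_(p + s, m + s))
  (muG muL : nat) :
  poly_part G D ->
  strong_linearization G A1 A0 B1 B0 C1 C0 D1 D0 ->
  mu G muG ->
  mu (prmx (lin_pencil A1 A0 B1 B0 C1 C0 D1 D0)) muL ->
  let d := pmx_deg D in
  let r := \rank G in
  let M := D1 + C1 *m invmx A1 *m B1 in
  [/\ M != 0 -> (muG + (r + s) = muL + d * r)%N,
      (0 < n)%N -> M = 0 -> (muG = muL + d * r)%N
    & n = 0%N -> D1 = 0 -> muG = (d * r)%N].
Proof.
move=> hD hL hG hmuL d r M.
have main : (muG + (M != 0%R) * (r + s) = muL + d * r)%N :=
  mu_strong_linearization hD hL hG hmuL.
split=> [M0|_ M0|n0 D10].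
- by move: main; rewrite M0 mul1n.
- by move: main; rewrite M0 eqxx mul0n addn0.
subst n; subst D1.
(* The product through dimension 0 vanishes, so [M = D1 = 0]; the pencil is then constant and
   [muL = 0]. *)
have M0 : M = 0.
  by rewrite /M (flatmx0 B1) mulmx0 addr0.
move: hmuL; rewrite lin_pencil_const => /mu_const muL0.
by move: main; rewrite M0 eqxx mul0n addn0 muL0 add0n.
Qed.
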